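(* Let $p\in[2,\infty)$. There exists a constant $C=C(a,b,d,K,L,\varrho,p)>0$ such that for every $n\ge\lfloor b-a\rfloor+1$ satisfying $Lh<1$ (with $h=(b-a)/n$) and every $(\eta,f)\in F^\varrho(a,b,d,K,L)$, $$\Bigl(\mathbb{E}\Bigl[\max_{0\le j\le n}\bigl\|z(t_j)-V^j_{S1}\bigr\|^p\Bigr]\Bigr)^{1/p}\le C h^{\varrho+\frac12},$$ where $z$ is the solution of $z'(t)=f(t,z(t))$, $t\in[a,b]$, $z(a)=\eta$, and $V^j_{S1}$ are the values produced by the semi-implicit randomized RK2 scheme (S1).
   Context: Let $-\infty<a<b<\infty$, $d\in\mathbb{Z}_+$, $\varrho\in(0,1]$, $K,L\in(0,\infty)$. The class $F^\varrho=F^\varrho(a,b,d,K,L)$ consists of pairs $(\eta,f)$ with $\eta\in\mathbb{R}^d$, $f\colon[a,b]\times\mathbb{R}^d\to\mathbb{R}^d$ such that: $\|\eta\|\le K$; $f$ is continuous; $\|f(t,x)\|\le K(1+\|x\|)$ for all $(t,x)$; $\|f(t,x)-f(s,x)\|\le L|t-s|^\varrho$ for all $t,s\in[a,b]$, $x\in\mathbb{R}^d$; $\|f(t,x)-f(t,y)\|\le L\|x-y\|$ for all $t\in[a,b]$, $x,y\in\mathbb{R}^d$. For $n\in\mathbb{Z}_+$ put $h=(b-a)/n$, $t_j=a+jh$. Let $\tau_1,\tau_2,\ldots$ be independent random variables uniformly distributed on $[0,1]$ on a complete probability space; $\theta_j=t_{j-1}+h\tau_j$. The semi-implicit randomized RK2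 scheme (S1) is: $V^0=\eta$, and for $j=1,\ldots,n$: $V_\tau^j=V^{j-1}+\tau_jhf(\theta_j,V_\tau^j)$ (the almost surely unique solution of this implicit equation, which exists when $Lh<1$), $V^j=V^{j-1}+hf(\theta_j,V_\tau^j)$. *)

(* Defs.v *)
From HB Require Import structures.
From mathcomp Require Import all_boot all_order all_algebra.
From mathcomp Require Import all_classical all_reals all_analysis.
Set Implicit Arguments. Unset Strict Implicit. Unset Printing Implicit Defensive.
Import Order.TTheory GRing.Theory Num.Theory.
Import numFieldNormedType.Exports.
Local Open Scope classical_set_scope.
Local Open Scope ring_scope.

Definition enorm {R : realType} {d : nat} (x : 'rV[R]_d) : R :=
  Num.sqrt (\sum_(i < d) x ord0 i ^+ 2).

Definition in_F {R : realType} (a b : R) (d : nat) (K L rho : R)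
  (eta : 'rV[R]_d) (f : R -> 'rV[R]_d -> 'rV[R]_d) : Prop :=
  [/\ enorm eta <= K,
      {within [set tx : R * 'rV[R]_d | a <= tx.1 <= b],
         continuous (fun tx : R * 'rV[R]_d => f tx.1 tx.2)},
      (forall t x, a <= t <= b -> enorm (f t x) <= K * (1 + enorm x)),
      (forall t s x, a <= t <= b -> a <= s <= b ->
          enorm (f t x - f s x) <= L * powR `|t - s| rho) &
      (forall t x y, a <= t <= b ->
          enorm (f t x - f t y) <= L * enorm (x - y))].

Definition ode_solution {R : realType} {d : nat} (a b : R)
  (eta : 'rV[R]_d) (f : R -> 'rV[R]_d -> 'rV[R]_d) (z : R -> 'rV[R]_d) : Prop :=
  [/\ z a = eta,
      {within `[a, b], continuous z} &
      (forall t, a < t < b -> is_derive t 1 z (f t (z t)))].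

Definition implicit_sol {R : realType} {d : nat}
  (f : R -> 'rV[R]_d -> 'rV[R]_d) (t c : R) (x : 'rV[R]_d) : 'rV[R]_d :=
  xget 0 [set y | y = x + c *: f t y].

(* Scheme (S1), driven by a realization tau : nat -> R of tau_1, tau_2, ...
   (tau 0 is unused); V^j for j = 0..n *)
Fixpoint schemeS1 {R : realType} {d : nat} (a h : R) (eta : 'rV[R]_d)
  (f : R -> 'rV[R]_d -> 'rV[R]_d) (tau : nat -> R) (j : nat) : 'rV[R]_d :=
  match j with
  | 0 => eta
  | j'.+1 =>
      let V := schemeS1 a h eta f tau j' in
      let theta := a + j'%:R * h + h * tau j in
      let Vt := implicit_sol f theta (tau j * h) V in
      V + h *: f theta Vt
  end.

Definition uniform01_rv {R : realType} {dT : measure_display}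
  {T : measurableType dT} (P : probability T R) (X : T -> R) : Prop :=
  measurable_fun setT X /\
  forall B : set R, measurable B ->
    P (X @^-1` B) = lebesgue_measure (B `&` `[0, 1]%classic).

Definition mutually_independent {R : realType} {dT : measure_display}
  {T : measurableType dT} (P : probability T R) (X : nat -> T -> R) : Prop :=
  forall (I : seq nat) (B : nat -> set R), uniq I ->
    (forall i, i \in I -> measurable (B i)) ->
    P (\bigcap_(i in [set i | i \in I]) (X i @^-1` B i)) =
    (\prod_(i <- I) P (X i @^-1` B i))%E.

(* Main.v *)
Require Import Defs.
From HB Require Import structures.
From mathcomp Require Import all_boot all_order all_algebra.
From mathcomp Require Import all_classical all_reals all_analysis.
From mathcomp Require Import measurable_realfun ring lra.
Set Implicit Arguments.
Unset Strict Implicit.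
Unset Printing Implicit Defensive.
Import Order.TTheory GRing.Theory Num.Theory.
Import numFieldNormedType.Exports.
Local Open Scope classical_set_scope.
Local Open Scope ring_scope.

(** Write [e_j = z(t_j) - V^j] and
    [xi_j = z(t_j) - z(t_(j-1)) - h f(theta_j, z(theta_j))]. Then
    [e_j = e_(j-1) + xi_j + h (f(theta_j, z(theta_j)) - f(theta_j, V_tau^j))],
    and the contraction [L h <= q < 1] bounds the last term by a multiple of
    [h (|e_(j-1)| + h^(1+rho))]; here [q] depends only on [L (b - a)], because
    [n > L (b - a)] is an integer. The discrete Gronwall lemma thus controls
    [max_j |e_j|], for every realisation with all [tau_j] in [[0, 1]], by the
    maximal partial sum of the [xi_j].

    The [xi_j] are independent, centred since [theta_j] is uniform on
    [[t_(j-1), t_j]], and [O(h^(1+rho))] since [t |-> f(t, z(t))] is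
    [rho]-Hoelder. Exponential moments give
    [E (xi_(i+1) + ... + xi_(i+k))^(2m) = O((k h^(2+2rho))^m)], and for [m >= 2]
    dyadic induction on the number of terms turns this increment bound into the
    same bound for the maximum, without any martingale inequality. Since
    [n h = b - a], this is the claimed rate. *)

(** * Euclidean norm and fixed points *)

(** Gives row vectors the joint structure of a complete normed module, on which Banach's fixed-point
    theorem is stated. *)
HB.instance Definition _ (R : realType) (m n : nat) :=
  Complete.on 'M[R]_(m, n).

Section EuclideanNorm.
Context {R : realType} {d : nat}.
Implicit Types x y : 'rV[R]_d.

Lemma enorm_ge0 x : 0 <= enorm x.
Proof. exact: sqrtr_ge0. Qed.

Lemma enorm_sqr x : enorm x ^+ 2 = \sum_(i < d) x ord0 i ^+ 2.
Proof. by rewrite sqr_sqrtr// sumr_ge0// => i _; rewrite sqr_ge0. Qed.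

Lemma coord_le_enorm x i : `|x ord0 i| <= enorm x.
Proof.
rewrite -(ler_sqr (x := `|_|)) ?nnegrE ?enorm_ge0// enorm_sqr real_normK ?num_real//.
by rewrite (bigD1 i)//= lerDl sumr_ge0// => j _; rewrite sqr_ge0.
Qed.

Lemma enorm_le_sum x : enorm x <= \sum_(i < d) `|x ord0 i|.
Proof.
have S0 : 0 <= \sum_(i < d) `|x ord0 i| by rewrite sumr_ge0.
rewrite -(ler_sqr (x := enorm x)) ?nnegrE ?enorm_ge0// enorm_sqr.
rewrite [leRHS]expr2 mulr_suml ler_sum// => i _.
rewrite -real_normK ?num_real// expr2 ler_wpM2l//.
by rewrite (bigD1 i)//= lerDl sumr_ge0.
Qed.

Lemma enorm_cauchy_schwarz x y :
  \sum_(i < d) x ord0 i * y ord0 i <= enorm x * enorm y.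
Proof.
have [x0|x0] := eqVneq (enorm x) 0.
  rewrite x0 mul0r big1// => i _.
  suff -> : x ord0 i = 0 by rewrite mul0r.
  by apply/eqP; rewrite -normr_le0 (le_trans (coord_le_enorm x i))// x0.
have [y0|y0] := eqVneq (enorm y) 0.
  rewrite y0 mulr0 big1// => i _.
  suff -> : y ord0 i = 0 by rewrite mulr0.
  by apply/eqP; rewrite -normr_le0 (le_trans (coord_le_enorm y i))// y0.
have A0 : 0 < enorm x by rewrite lt_def x0 enorm_ge0.
have B0 : 0 < enorm y by rewrite lt_def y0 enorm_ge0.
(* With both norms positive, this sum of squares equals [2 |x| |y| (|x| |y| - <x, y>)], and the
   positive factor cancels. *)
have : 0 <= \sum_(i < d) (enorm y * x ord0 i - enorm x * y ord0 i) ^+ 2.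
  by rewrite sumr_ge0// => i _; rewrite sqr_ge0.
rewrite (eq_bigr (fun i => enorm y ^+ 2 * x ord0 i ^+ 2
    - (enorm x * enorm y) *+ 2 * (x ord0 i * y ord0 i)
    + enorm x ^+ 2 * y ord0 i ^+ 2)); last by move=> i _; ring.
rewrite big_split sumrB/= -!mulr_sumr -!enorm_sqr.
set S := \sum_(i < d) _ => H.
rewrite -(ler_pM2l (mulr_gt0 A0 B0)).
move: H; set u := enorm x; set v := enorm y => H.
rewrite -subr_ge0 -(pmulrn_lge0 _ (isT : (0 < 2)%N)).
by apply: le_trans H _; rewrite le_eqVlt; apply/orP; left; apply/eqP; ring.
Qed.

Lemma enormD x y : enorm (x + y) <= enorm x + enorm y.
Proof.
rewrite -(ler_sqr (x := enorm _)) ?nnegrE ?addr_ge0 ?enorm_ge0//.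
rewrite sqrrD !enorm_sqr.
rewrite (eq_bigr (fun i => x ord0 i ^+ 2 + (x ord0 i * y ord0 i) *+ 2
  + y ord0 i ^+ 2)); last by move=> i _; rewrite mxE sqrrD.
rewrite 2!big_split/= sumrMnl lerD2r lerD2l lerMn2r/=.
exact: enorm_cauchy_schwarz.
Qed.

Lemma enormZ (c : R) x : enorm (c *: x) = `|c| * enorm x.
Proof.
rewrite /enorm (eq_bigr (fun i => c ^+ 2 * x ord0 i ^+ 2)); last first.
  by move=> i _; rewrite mxE exprMn.
by rewrite -mulr_sumr sqrtrM ?sqr_ge0// sqrtr_sqr.
Qed.

Lemma enorm_le0 x : enorm x <= 0 -> x = 0.
Proof.
move=> x0; apply/rowP => i; rewrite mxE; apply/eqP.
by rewrite -normr_le0 (le_trans (coord_le_enorm x i)).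
Qed.

Lemma normr_le_enorm x : `|x| <= enorm x.
Proof.
rewrite [leLHS]/Num.Def.normr/= mx_normrE; apply: bigmax_le.
  exact: enorm_ge0.
by move=> [i j] _ /=; rewrite ord1 coord_le_enorm.
Qed.

Lemma enorm_le_normr x : enorm x <= d%:R * `|x|.
Proof.
apply: le_trans (enorm_le_sum x) _.
rewrite mulr_natl -[X in _ *+ X]card_ord -sumr_const ler_sum// => i _.
rewrite [leRHS]/Num.Def.normr/= mx_normrE.
exact: (le_bigmax _ (fun ij => `|x ij.1 ij.2|) (ord0, i)).
Qed.

(* The map contracts the Euclidean norm only, but a high enough iterate
   contracts the sup norm, for which Banach's theorem is available. *)
Lemma enorm_contraction_fixpoint (Phi : 'rV[R]_d -> 'rV[R]_d) (q : R) :
  0 <= q -> q < 1 ->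
  (forall x y, enorm (Phi x - Phi y) <= q * enorm (x - y)) ->
  exists y, y = Phi y.
Proof.
move=> q0 q1 PhiL.
have iterL k x y : enorm (iter k Phi x - iter k Phi y) <= q ^+ k * enorm (x - y).
  elim: k => [|k IH]; first by rewrite expr0 mul1r.
  by rewrite /= exprS -mulrA (le_trans (PhiL _ _))// ler_wpM2l.
(* The factor [d + 1] yields both [d q^k < 1], the contraction in the sup norm, and [q^k < 1], which
   must also hold when [d = 0]. *)
have : (d%:R + 1) * q ^+ k @[k --> \oo] --> (0 : R).
  rewrite -[0](mulr0 (d%:R + 1)); apply: cvgMr; apply: cvg_expr.
  by rewrite ger0_norm.
move=> /cvgrPdist_lt/(_ 1 ltr01)[k _ /(_ k (leqnn k))].
rewrite /= sub0r normrN ger0_norm ?mulr_ge0 ?exprn_ge0 ?addr_ge0// => qk1.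
have dq1 : d%:R * q ^+ k < 1.
  by apply: le_lt_trans qk1; rewrite ler_wpM2r ?exprn_ge0// lerDl.
have qk_lt1 : q ^+ k < 1.
  by apply: le_lt_trans qk1; rewrite ler_peMl ?exprn_ge0// lerDr.
have dq0 : 0 <= d%:R * q ^+ k by rewrite mulr_ge0 ?exprn_ge0.
have [p _ pE] : exists2 p, [set: 'rV[R]_d] p & p = iter k Phi p.
  pose F := [fun of totalfun (iter k Phi)].
  have ctrF : is_contraction F.
    exists (NngNum dq0); split => //= -[x y] _ /=.
    apply: le_trans (normr_le_enorm _) _.
    apply: le_trans (iterL k x y) _.
    by rewrite (mulrC d%:R) -mulrA ler_wpM2l ?exprn_ge0// enorm_le_normr.
  pose X : completeNormedModType R := 'rV[R]_d.
  have := @banach_fixed_point R X setT F ctrF (@closedT X).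
  by apply; exists 0.
(* [Phi p] is fixed by the iterate as well, so [|Phi p - p| <= q^k |Phi p - p|], which forces
   equality. *)
exists p; apply/eqP; rewrite eq_sym -subr_eq0; apply/eqP/enorm_le0.
have := iterL k (Phi p) p.
rewrite -iterSr/= -pE => H.
rewrite leNgt; apply/negP => e0.
by move: H; rewrite leNgt gtr_pMl// qk_lt1.
Qed.

End EuclideanNorm.

(** * Independence and exponential moments *)

Section Independence.
Local Open Scope ereal_scope.
Context {R : realType} {dT : measure_display} {T : measurableType dT}.
Variable P : probability T R.
Import HBNNSimple.

(** Linearity: a simple function is a finite combination of indicators of its level sets, to which
    the hypothesis on [\1_B] applies. *)
Let product_rule_nnsfun (X : T -> R) (Z : T -> R) (s : {nnsfun R >-> R}) :
  measurable_fun setT X -> measurable_fun setT Z -> (forall w, 0 <= Z w)%R ->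
  (forall B, measurable B -> \int[P]_w (\1_B (X w) * Z w)%:E =
     P (X @^-1` B) * \int[P]_w (Z w)%:E) ->
  \int[P]_w (s (X w) * Z w)%:E = (\int[P]_w (s (X w))%:E) * \int[P]_w (Z w)%:E.
Proof.
move=> mX mZ Z0 XZ.
have mZ' : measurable_fun setT (fun w => (Z w)%:E) by exact/measurable_EFinP.
have ms r : measurable (s @^-1` [set r]) by [].
have mi r : measurable_fun setT (fun w => (\1_(s @^-1` [set r]) (X w))%:E : \bar R).
  by apply/measurable_EFinP; exact: measurableT_comp.
have mri r : measurable_fun setT (fun w => (r * \1_(s @^-1` [set r]) (X w))%:E : \bar R).
  by under eq_fun do rewrite EFinM; exact: emeasurable_funM.
have r0 (r : R) (w : T) : 0 <= (r * \1_(s @^-1` [set r]) (X w))%:E.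
  by rewrite EFinM nnfun_muleindic_ge0.
under eq_integral.
  move=> w _; rewrite EFinM fimfunE -fsumEFin// ge0_mule_fsuml//.
  over.
rewrite ge0_integral_fsum//; last 2 first.
  - by move=> r; exact: emeasurable_funM.
  - by move=> r w _; rewrite mule_ge0// lee_fin.
under [X in _ = X * _]eq_integral do rewrite fimfunE -fsumEFin//.
rewrite [X in _ = X * _]ge0_integral_fsum//.
rewrite ge0_mule_fsuml; last by move=> r; exact: integral_ge0.
apply: eq_fsbigr => r /[!inE] -[x _ <-].
have sx0 : 0 <= (s x)%:E by rewrite lee_fin.
under eq_integral do rewrite -EFinM -mulrA EFinM.
rewrite ge0_integralZl//; last 2 first.
  - by under eq_fun do rewrite EFinM; exact: emeasurable_funM.
  - by move=> w _; rewrite lee_fin mulr_ge0.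
rewrite XZ// muleA; congr (_ * _).
under eq_integral do rewrite EFinM.
rewrite ge0_integralZl//.
congr (_ * _).
by rewrite -[RHS]/(\int[P]_w (\1_(X @^-1` (s @^-1` [set s x])) w)%:E)
  integral_indic// ?setIT// -[X in measurable X]setTI; exact: mX.
Qed.

(** Monotone convergence along simple functions increasing to [g]; finiteness of the integral of [Z]
    lets it pass to the limit as a constant factor. *)
Lemma ge0_integralM_product_rule (X : T -> R) (Z : T -> R) (g : R -> R) :
  measurable_fun setT X -> measurable_fun setT Z -> (forall w, 0 <= Z w)%R ->
  (forall B, measurable B -> \int[P]_w (\1_B (X w) * Z w)%:E =
     P (X @^-1` B) * \int[P]_w (Z w)%:E) ->
  \int[P]_w (Z w)%:E \is a fin_num ->
  measurable_fun setT g -> (forall x, 0 <= g x)%R ->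
  \int[P]_w (g (X w) * Z w)%:E = (\int[P]_w (g (X w))%:E) * \int[P]_w (Z w)%:E.
Proof.
move=> mX mZ Z0 XZ Zfin mg g0.
have mg' : measurable_fun setT (EFin \o g) by exact/measurable_EFinP.
pose f_ := nnsfun_approx measurableT mg'.
have f_g x : (f_ n x)%:E @[n --> \oo] --> (g x)%:E.
  by apply: (cvg_nnsfun_approx measurableT mg') => // ? _; rewrite lee_fin.
have ndf x m n : (m <= n)%N -> ((f_ m x)%:E <= (f_ n x)%:E).
  by move=> mn; rewrite lee_fin; exact/lefP/nd_nnsfun_approx.
have mf n : measurable_fun setT (fun w => (f_ n (X w))%:E : \bar R).
  by apply/measurable_EFinP; exact: measurableT_comp.
have cvg1 : \int[P]_w (f_ n (X w) * Z w)%:E @[n --> \oo] -->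
    \int[P]_w (g (X w) * Z w)%:E.
  have -> : \int[P]_w (g (X w) * Z w)%:E =
      \int[P]_w limn (fun n => (f_ n (X w) * Z w)%:E).
    apply: eq_integral => w _; apply/esym/cvg_lim => //.
    under eq_fun do rewrite EFinM; rewrite EFinM.
    by apply: cvgeZr => //; exact: f_g.
  apply: cvg_monotone_convergence => //.
  - move=> n; under eq_fun do rewrite EFinM.
    by apply: emeasurable_funM => //; exact/measurable_EFinP.
  - by move=> n w _; rewrite lee_fin mulr_ge0.
  - by move=> w _ m n mn; rewrite !EFinM lee_wpmul2r ?lee_fin// -lee_fin ndf.
have cvg2 : \int[P]_w (f_ n (X w))%:E @[n --> \oo] --> \int[P]_w (g (X w))%:E.
  have -> : \int[P]_w (g (X w))%:E = \int[P]_w limn (fun n => (f_ n (X w))%:E).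
    by apply: eq_integral => w _; apply/esym/cvg_lim => //; exact: f_g.
  apply: cvg_monotone_convergence => //.
  - by move=> n w _; rewrite lee_fin.
  - by move=> w _ m n mn; rewrite ndf.
apply: (cvg_unique _ cvg1) => //.
have -> : (fun n => \int[P]_w (f_ n (X w) * Z w)%:E) =
    (fun n => \int[P]_w (f_ n (X w))%:E * \int[P]_w (Z w)%:E).
  by apply/funext => n; exact: product_rule_nnsfun.
exact: cvgeZr.
Qed.

(** Mixing functions and indicators lets the induction on [I1] close. With [I1] empty this is the
    definition of independence; to add an index to [I1], the indicator case is the induction
    hypothesis with that index placed in [I2]. *)
Lemma product_rule_indic_funs (X : nat -> T -> R) (I1 I2 : seq nat)
    (g : nat -> R -> R) (B : nat -> set R) :
  (forall i, measurable_fun setT (X i)) -> mutually_independent P X ->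
  uniq (I1 ++ I2) -> (forall i, measurable (B i)) ->
  (forall i, measurable_fun setT (g i)) -> (forall i x, 0 <= g i x)%R ->
  (forall i, \int[P]_w (g i (X i w))%:E \is a fin_num) ->
  \int[P]_w ((\prod_(i <- I1) g i (X i w)) *
             \prod_(i <- I2) \1_(B i) (X i w))%:E =
  (\prod_(i <- I1) \int[P]_w (g i (X i w))%:E) *
  \prod_(i <- I2) P (X i @^-1` B i).
Proof.
move=> mX indep + + mg g0 gfin.
elim: I1 I2 B => [I2 B /= uI mB|j I1 IH I2 B /= /andP[jI uI] mB].
  under eq_integral do rewrite big_nil mul1r.
  rewrite big_nil mul1e -indep//.
  set A := \bigcap_(i in _) _.
  have mA : measurable A.
    rewrite /A bigcap_seq; apply: bigsetI_measurable => i _.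
    by rewrite -[X in measurable X]setTI; exact: mX.
  rewrite -[A in RHS]setIT -integral_indic//.
  apply: eq_integral => w _; congr EFin.
  rewrite [RHS]indicE.
  have [wI|wI] := boolP (w \in A).
    rewrite big_seq big1// => i iI; rewrite indicE mem_set//.
    by move/set_mem : wI; exact.
  have [i iI wi] : exists2 i, i \in I2 & ~ B i (X i w).
    apply: contrapT => H; move/negP : wI; apply; rewrite inE => i /= iI.
    by apply: contrapT => Bi; apply: H; exists i.
  by rewrite (big_rem i)//= indicE memNset// mul0r.
have jI1 : j \notin I1 by apply: contra jI; rewrite mem_cat => ->.
have jI2 : j \notin I2 by apply: contra jI; rewrite mem_cat => ->; rewrite orbT.
pose Z w := ((\prod_(i <- I1) g i (X i w)) * \prod_(i <- I2) \1_(B i) (X i w))%R.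
have mZ : measurable_fun setT Z.
  apply: measurable_funM; apply: measurable_prod => i _.
    exact: measurableT_comp.
  by apply: measurableT_comp => //; exact: measurable_indic.
have Z0 w : (0 <= Z w)%R by rewrite mulr_ge0// prodr_ge0.
have IZ : \int[P]_w (Z w)%:E = (\prod_(i <- I1) \int[P]_w (g i (X i w))%:E) *
  \prod_(i <- I2) P (X i @^-1` B i) by exact: IH.
have Zfin : \int[P]_w (Z w)%:E \is a fin_num.
  rewrite IZ fin_numM//; elim/big_rec: _ => // i x _ xf; rewrite fin_numM//.
  by rewrite fin_num_measure// -[X in measurable X]setTI; exact: mX.
under eq_integral do rewrite big_cons -mulrA -/(Z _).
rewrite (ge0_integralM_product_rule (mX j) mZ Z0)//.
  by rewrite big_cons IZ muleA.
move=> C mC.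
(* Since [j] is not in [I2], prescribing [C] at [j] leaves the other events unchanged. *)
pose B' i := if i == j then C else B i.
have B'I2 i : i \in I2 -> B' i = B i.
  by move=> iI2; rewrite /B'; case: eqP => // ij; move: jI2; rewrite -ij iI2.
have -> : \int[P]_w (\1_C (X j w) * Z w)%:E = \int[P]_w
  ((\prod_(i <- I1) g i (X i w)) * \prod_(i <- j :: I2) \1_(B' i) (X i w))%:E.
  apply: eq_integral => w _; congr EFin; rewrite big_cons {1}/B' eqxx.
  rewrite /Z mulrCA; congr (_ * (_ * _))%R.
  by rewrite [LHS]big_seq [RHS]big_seq; apply: eq_bigr => i /B'I2 ->.
rewrite IH.
- rewrite big_cons {1}/B' eqxx muleCA IZ; congr (_ * (_ * _)).
  by rewrite [LHS]big_seq [RHS]big_seq; apply: eq_bigr => i /B'I2 ->.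
- by rewrite -cat1s uniq_catCA /= jI.
- by move=> i; rewrite /B'; case: ifP.
Qed.

Lemma expectation_prod_independent (X : nat -> T -> R) (I : seq nat)
    (g : nat -> R -> R) :
  (forall i, measurable_fun setT (X i)) -> mutually_independent P X ->
  uniq I ->
  (forall i, measurable_fun setT (g i)) -> (forall i x, 0 <= g i x)%R ->
  (forall i, \int[P]_w (g i (X i w))%:E \is a fin_num) ->
  \int[P]_w (\prod_(i <- I) g i (X i w))%:E =
  \prod_(i <- I) \int[P]_w (g i (X i w))%:E.
Proof.
move=> mX indep uI mg g0 gfin.
have := @product_rule_indic_funs X I [::] g (fun=> setT) mX indep.
rewrite cats0 big_nil mule1 => <-//.
by apply: eq_integral => w _; rewrite big_nil mulr1.
Qed.

End Independence.

Section ExponentialMoments.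
Context {R : realType}.

(** Invert [1 - x <= expR (- x)]: the product [(1 + x + 2 x^2) (1 - x) = 1 + x^2 (1 - 2 x)] is at
    least 1 for [x <= 1/2]. *)
Lemma expR_le_quadratic (x : R) : `|x| <= 2^-1 -> expR x <= 1 + x + 2 * x ^+ 2.
Proof.
rewrite ler_norml => /andP[x1 x2].
have H : 1 - x <= expR (- x) by exact: expR_ge1Dx.
have e0 := expR_gt0 (- x).
have -> : expR x = (expR (- x))^-1 by rewrite expRN invrK.
rewrite -div1r ler_pdivrMr//.
apply: (@le_trans _ _ ((1 + x + 2 * x ^+ 2) * (1 - x))); first by nra.
by rewrite ler_wpM2l//; nra.
Qed.

(** [|x|^n / n!] is a single term of the exponential series of [|x|], and [expR |x|] is one of the
    two summands on the right. *)
Lemma normrX_le_expR (x : R) n : `|x| ^+ n <= n`!%:R * (expR x + expR (- x)).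
Proof.
have H (y : R) : 0 <= y -> y ^+ n <= n`!%:R * expR y.
  case: n => [|n] y0.
    by rewrite expr0 fact0 mul1r -expR0 ler_expR.
  rewrite mulrC -ler_pdivrMr ?ltr0n ?fact_gt0//.
  by apply: le_trans (expR_ge1Dxn n y0); rewrite lerDr.
apply: le_trans (H _ (normr_ge0 x)) _; rewrite ler_wpM2l//.
have [x0|x0] := leP 0 x; first by rewrite ger0_norm// lerDl expR_ge0.
by rewrite ltr0_norm// lerDr expR_ge0.
Qed.

Local Open Scope ereal_scope.
Context {dT : measure_display} {T : measurableType dT} (P : probability T R).

Lemma integrable_bounded_comp (X : T -> R) (g : R -> R) (M : R) :
  measurable_fun setT X -> measurable_fun setT g ->
  (forall x, `|g x| <= M)%R -> P.-integrable setT (fun w => (g (X w))%:E).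
Proof.
move=> mX mg gM.
apply: measurable_bounded_integrable => //.
- by rewrite [X in X < _]probability_setT ltry.
- exact: measurableT_comp.
- exists M; split; first exact: num_real.
  by move=> y My w _ /=; rewrite (le_trans (gM _))// ltW.
Qed.

(** On integrating the quadratic bound the linear term vanishes, which leaves
    [1 + 2 M^2 <= expR (2 M^2)]. *)
Lemma integral_expR_le (X : T -> R) (g : R -> R) (M : R) :
  measurable_fun setT X -> measurable_fun setT g ->
  (forall x, `|g x| <= M)%R -> (M <= 2^-1)%R ->
  \int[P]_w (g (X w))%:E = 0 ->
  \int[P]_w (expR (g (X w)))%:E <= (expR (2 * M ^+ 2))%:E.
Proof.
move=> mX mg gM M12 g0.
have M0 : (0 <= M)%R by exact: le_trans (gM 0%R).
have ig := integrable_bounded_comp mX mg gM.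
apply: (@le_trans _ _ (\int[P]_w ((1 + 2 * M ^+ 2)%:E + (g (X w))%:E))).
  apply: ge0_le_integral => //.
  - apply/measurable_EFinP; apply: measurableT_comp => //.
    exact: measurableT_comp.
  - apply: emeasurable_funD => //.
    by apply/measurable_EFinP; exact: measurableT_comp.
  - move=> w _; rewrite -EFinD lee_fin.
    apply: le_trans (expR_le_quadratic (le_trans (gM _) M12)) _.
    have : (g (X w) ^+ 2 <= M ^+ 2)%R.
      by rewrite -real_normK ?num_real// lerXn2r ?nnegrE.
    lra.
rewrite integralD//; last exact: finite_measure_integrable_cst.
rewrite g0 adde0 integral_cst// [X in _ * X](@probability_setT _ _ _ P) mule1 lee_fin.
exact: expR_ge1Dx.
Qed.

Lemma integral_expR_sum_le (X : nat -> T -> R) (g : nat -> R -> R) (M : R)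
    (I : seq nat) :
  (forall i, measurable_fun setT (X i)) -> mutually_independent P X -> uniq I ->
  (forall i, measurable_fun setT (g i)) ->
  (forall i x, `|g i x| <= M)%R -> (M <= 2^-1)%R ->
  (forall i, \int[P]_w (g i (X i w))%:E = 0) ->
  \int[P]_w (expR (\sum_(i <- I) g i (X i w)))%:E <=
  (expR (2 * M ^+ 2 * (size I)%:R))%:E.
Proof.
move=> mX indep uI mg gM M12 g0.
have Hi i := integral_expR_le (mX i) (mg i) (gM i) M12 (g0 i).
under eq_integral do rewrite expR_sum.
rewrite (@expectation_prod_independent _ _ _ P X I (fun i x => expR (g i x)))//.
- elim: {uI} I => [|i I IH]; first by rewrite big_nil mulr0 expR0.
  rewrite big_cons /= -(natr1 (size I)) mulrDr mulr1 expRD mulrC EFinM.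
  rewrite lee_pmul//; first by rewrite integral_ge0// => w _; rewrite lee_fin expR_ge0.
  elim/big_rec: _ => // j x _ x0; rewrite mule_ge0//.
  by rewrite integral_ge0// => w _; rewrite lee_fin expR_ge0.
- by move=> i; exact: measurableT_comp.
- move=> i; rewrite ge0_fin_numE; last first.
    by rewrite integral_ge0// => w _; rewrite lee_fin expR_ge0.
  exact: le_lt_trans (Hi i) (ltry _).
Qed.

(** An even power of the sum [S] is dominated by [expR (lam S) + expR (- lam S)], and both
    exponential moments factorise by independence. *)
Lemma integral_sum_exprn_le (X : nat -> T -> R) (g : nat -> R -> R) (M : R)
    (I : seq nat) (m : nat) :
  (forall i, measurable_fun setT (X i)) -> mutually_independent P X -> uniq I ->
  (forall i, measurable_fun setT (g i)) ->
  (0 < M)%R -> (forall i x, `|g i x| <= M)%R ->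
  (forall i, \int[P]_w (g i (X i w))%:E = 0) -> (0 < size I)%N ->
  \int[P]_w ((\sum_(i <- I) g i (X i w)) ^+ m.*2)%:E <=
  (((m.*2)`!%:R * (expR 2^-1 *+ 2)) * (4 * M ^+ 2 * (size I)%:R) ^+ m)%:E.
Proof.
move=> mX indep uI mg M0 gM g0 k0.
set k := (size I)%:R : R.
have k1 : (1 <= k)%R by rewrite ler1n.
pose s := Num.sqrt k.
have s0 : (0 < s)%R by rewrite sqrtr_gt0 (lt_le_trans ltr01).
have s2 : (s ^+ 2 = k)%R by rewrite sqr_sqrtr// (le_trans ler01).
have s1 : (1 <= s)%R by rewrite -[leLHS]sqrtr1 ler_wsqrtr.
(* With [k] terms this scale makes the exponent [2 (lam M)^2 k] equal to [1/2], while [lam M <= 1/2]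
   because [s >= 1]; moreover [lam^-2 = 4 M^2 k], the base of the claimed power. *)
pose lam := (2 * M * s)^-1%R.
have lam0 : (0 < lam)%R by rewrite invr_gt0 !mulr_gt0.
have lamM : (lam * M = (2 * s)^-1)%R by rewrite /lam; field; lra.
have E (c : R) : (`|c| = lam)%R ->
    \int[P]_w (expR (\sum_(i <- I) c * g i (X i w)))%:E <= (expR 2^-1)%:E.
  move=> cl.
  apply: le_trans (@integral_expR_sum_le X (fun i x => c * g i x)%R (lam * M) I
    mX indep uI _ _ _ _) _.
  - by move=> i; apply: measurable_funM.
  - by move=> i x; rewrite normrM cl ler_wpM2l// ltW.
  - by rewrite lamM lef_pV2 ?posrE ?mulr_gt0//; lra.
  - move=> i; under eq_integral do rewrite EFinM.
    rewrite integralZl//; first by rewrite g0 mule0.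
    exact: (integrable_bounded_comp (mX i) (mg i) (gM i)).
  - rewrite lee_fin ler_expR lamM -/k -s2 le_eqVlt; apply/orP; left; apply/eqP.
    by field; lra.
have mS : measurable_fun setT (fun w => \sum_(i <- I) g i (X i w))%R.
  by apply: measurable_sum => i; exact: measurableT_comp.
have mexp (c : R) : measurable_fun setT
    (fun w => (expR (\sum_(i <- I) c * g i (X i w)))%:E : \bar R).
  apply/measurable_EFinP; apply: measurableT_comp => //.
  by apply: measurable_sum => i; apply: measurable_funM => //; exact: measurableT_comp.
set D := ((m.*2)`!%:R * (4 * M ^+ 2 * k) ^+ m)%R.
have D0 : (0 <= D)%R by rewrite mulr_ge0// exprn_ge0// !mulr_ge0// ltW.
apply: (@le_trans _ _ (\int[P]_w (D%:E *
    ((expR (\sum_(i <- I) lam * g i (X i w)))%:E +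
     (expR (\sum_(i <- I) (- lam) * g i (X i w)))%:E)))).
  apply: ge0_le_integral => //.
  - by move=> w _; rewrite lee_fin exprn_even_ge0// odd_double.
  - by apply/measurable_EFinP; exact: measurable_funX.
  - by apply: emeasurable_funM => //; exact: emeasurable_funD.
  - move=> w _; rewrite -EFinD -EFinM lee_fin.
    set S := (\sum_(i <- I) g i (X i w))%R.
    rewrite -!mulr_sumr -/S mulNr.
    have := normrX_le_expR (lam * S) m.*2.
    rewrite -normrX ger0_norm; last by rewrite exprn_even_ge0// odd_double.
    rewrite exprMn => H.
    have lamD : ((4 * M ^+ 2 * k) ^+ m * lam ^+ m.*2 = 1)%R.
      rewrite -mul2n exprM -exprMn -s2 /lam.
      have -> : (4 * M ^+ 2 * s ^+ 2 * (2 * M * s)^-1 ^+ 2 = 1)%R by field; lra.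
      by rewrite expr1n.
    rewrite /D -[leRHS]mulrA [leRHS]mulrCA -[leLHS]mul1r -[in leLHS]lamD.
    rewrite -[leLHS]mulrA ler_wpM2l//.
    by rewrite exprn_ge0// !mulr_ge0// ltW.
rewrite ge0_integralZl//; last 2 first.
  - exact: emeasurable_funD.
  - by move=> w _; rewrite adde_ge0// lee_fin expR_ge0.
rewrite ge0_integralD//.
have -> : (((m.*2)`!%:R * (expR 2^-1 *+ 2)) * (4 * M ^+ 2 * k) ^+ m =
   D * (expR 2^-1 + expR 2^-1))%R by rewrite /D; ring.
rewrite [leRHS]EFinM lee_wpmul2l ?lee_fin// EFinD leeD// E// ?normrN gtr0_norm//.
Qed.

End ExponentialMoments.

(** * Maximal inequality *)

Section MaximalInequality.
Context {R : realType}.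

(** The starting index is free because the dyadic induction also applies its bound to shifted
    blocks. *)
Definition max_partial_sum (x : nat -> R) (i n : nat) : R :=
  \big[Num.max/0]_(k < n.+1) `|\sum_(i <= j < i + k) x j|.

Lemma max_partial_sum_ge0 x i n : 0 <= max_partial_sum x i n.
Proof.
by rewrite /max_partial_sum; elim/big_rec: _ => // k y _ y0; rewrite le_max y0 orbT.
Qed.

Lemma le_max_partial_sum x i n k : (k <= n)%N ->
  `|\sum_(i <= j < i + k) x j| <= max_partial_sum x i n.
Proof.
move=> kn; have kn' : (k < n.+1)%N by [].
exact: (le_bigmax _ (fun k : 'I_n.+1 => `|\sum_(i <= j < i + k) x j|) (Ordinal kn')).
Qed.

Lemma max_partial_sum_le x i n y : 0 <= y ->
  (forall k, (k <= n)%N -> `|\sum_(i <= j < i + k) x j| <= y) ->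
  max_partial_sum x i n <= y.
Proof. by move=> y0 H; apply: bigmax_le => // k _; apply: H; rewrite -ltnS. Qed.

(** A partial sum longer than [n] is the whole first block plus a partial sum of the second. *)
Lemma max_partial_sum_double x i n : max_partial_sum x i (n + n) <=
  Num.max (max_partial_sum x i n)
          (max_partial_sum x (i + n) n + `|\sum_(i <= j < i + n) x j|).
Proof.
apply: max_partial_sum_le.
  by rewrite le_max max_partial_sum_ge0.
move=> k kn; rewrite le_max; have [kn'|nk] := leqP k n.
  by rewrite le_max_partial_sum.
apply/orP; right.
have -> : (i + k = (i + n) + (k - n))%N by rewrite -addnA subnKC// ltnW.
rewrite (@big_cat_nat _ _ _ (i + n)%N)/= ?leq_addr//.
rewrite addrC; apply: le_trans (ler_normD _ _) _; rewrite lerD2r.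
by apply: le_max_partial_sum; rewrite leq_subLR.
Qed.

(** The coefficient 2 of [x ^+ q], instead of an exponential in [q], is what keeps the dyadic
    recursion closed. If [y] is at most [x / (2 q)], then [(1 + 1/(2 q))^q <= expR (1/2) <= 2];
    otherwise [y] dominates [x] up to the factor [2 q]. *)
Lemma exprDn_le2 (q : nat) (x y : R) : (0 < q)%N -> 0 <= x -> 0 <= y ->
  (x + y) ^+ q <= 2 * x ^+ q + (1 + q.*2%:R) ^+ q * y ^+ q.
Proof.
move=> q0 x0 y0; set c : R := q.*2%:R.
have c0 : 0 < c by rewrite ltr0n double_gt0.
have [xy|xy] := leP (c * y) x.
  apply: (@le_trans _ _ (2 * x ^+ q)); last first.
    by rewrite lerDl mulr_ge0// exprn_ge0// addr_ge0// ltW.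
  apply: (@le_trans _ _ ((1 + c^-1) ^+ q * x ^+ q)).
    rewrite -exprMn lerXn2r ?nnegrE ?addr_ge0 ?mulr_ge0 ?addr_ge0 ?invr_ge0 ?(ltW c0)//.
    by rewrite mulrDl mul1r lerD2l mulrC ler_pdivlMr// mulrC.
  rewrite ler_wpM2r ?exprn_ge0//.
  apply: (@le_trans _ _ (expR c^-1 ^+ q)).
    by rewrite lerXn2r ?nnegrE ?expR_ge0 ?expR_ge1Dx// addr_ge0 ?invr_ge0 ?(ltW c0).
  rewrite -expRM_natl.
  have -> : q%:R * c^-1 = 2^-1 :> R.
    rewrite /c -mul2n natrM; by field; rewrite pnatr_eq0 -lt0n.
  apply: le_trans (expR_le_quadratic _) _; first by rewrite ger0_norm.
  by lra.
apply: (@le_trans _ _ ((1 + c) ^+ q * y ^+ q)); last first.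
  by rewrite lerDr mulr_ge0// exprn_ge0.
rewrite -exprMn lerXn2r ?nnegrE ?addr_ge0 ?mulr_ge0 ?addr_ge0 ?(ltW c0)//.
by rewrite addrC mulrDl mul1r lerD2l ltW.
Qed.

Local Open Scope ereal_scope.
Context {dT : measure_display} {T : measurableType dT} (P : probability T R).

Lemma measurable_max_partial_sum (x : nat -> T -> R) i n :
  (forall j, measurable_fun setT (x j)) ->
  measurable_fun setT (fun w => max_partial_sum (fun j => x j w) i n).
Proof.
move=> mx.
have mmax k (F : 'I_k -> T -> R) : (forall i, measurable_fun setT (F i)) ->
    measurable_fun setT (fun w => \big[Num.max/0%R]_(i < k) F i w).
  elim: k F => [|k IH] F mF.
    rewrite (_ : (fun w => _) = cst 0%R)//.
    by apply/funext => w; rewrite big_ord0.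
  under eq_fun do rewrite big_ord_recl.
  by apply: measurable_maxr => //; exact: IH.
apply: mmax => k; apply: measurableT_comp => //; exact: measurable_sum.
Qed.

(* Doubling the length costs a factor 3 plus one increment, while the claimed
   bound is allowed to grow by [2 ^ m >= 4]. *)
Lemma dyadic_maximal_inequality (x : nat -> T -> R) (m : nat) (D : R) :
  (1 < m)%N -> (0 <= D)%R -> (forall j, measurable_fun setT (x j)) ->
  (forall i k, (0 < k)%N ->
    \int[P]_w ((\sum_(i <= j < i + k) x j w) ^+ m.*2)%:E <= (D * k%:R ^+ m)%:E) ->
  forall N i, \int[P]_w (max_partial_sum (fun j => x j w) i (2 ^ N) ^+ m.*2)%:E
    <= ((1 + (m.*2).*2%:R) ^+ m.*2 * D * (2 ^ N)%:R ^+ m)%:E.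
Proof.
move=> m1 D0 mx xD.
(* The coefficient of [y ^+ q] in [exprDn_le2] at [q = m.*2]; with it in the claim, the increment
   between the blocks costs exactly one more copy of the bound. *)
set c : R := (((1 + (m.*2).*2%:R) ^+ m.*2))%R.
have c1 : (1 <= c)%R by rewrite exprn_ege1// lerDl.
have c0 : (0 <= c)%R by exact: le_trans c1.
have mm i n : measurable_fun setT
    (fun w => (max_partial_sum (fun j => x j w) i n ^+ m.*2)%:E : \bar R).
  by apply/measurable_EFinP; apply: measurable_funX; exact: measurable_max_partial_sum.
have m0 i n w : (0 <= max_partial_sum (fun j => x j w) i n ^+ m.*2)%R.
  by rewrite exprn_ge0// max_partial_sum_ge0.
have s0 i k w : (0 <= (\sum_(i <= j < i + k) x j w) ^+ m.*2)%R.
  by rewrite exprn_even_ge0// odd_double.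
have ms i k : measurable_fun setT
    (fun w => ((\sum_(i <= j < i + k) x j w) ^+ m.*2)%:E : \bar R).
  by apply/measurable_EFinP; apply: measurable_funX; exact: measurable_sum.
elim=> [i|N IH i].
  rewrite expn0; apply: (@le_trans _ _ (D * 1 ^+ m)%:E); last first.
    by rewrite lee_fin ler_wpM2r ?exprn_ge0// ler_peMl.
  apply: le_trans (xD i 1%N isT).
  apply: ge0_le_integral => //.
  - by move=> w _; rewrite lee_fin.
  - move=> w _; rewrite lee_fin -(ger0_norm (s0 _ _ _)) normrX.
    rewrite lerXn2r ?nnegrE ?max_partial_sum_ge0//.
    apply: max_partial_sum_le => // -[|[|//]] _ //.
    by rewrite addn0 big_geq// normr0.
have -> : (2 ^ N.+1 = 2 ^ N + 2 ^ N)%N by rewrite expnS mul2n addnn.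
set n := (2 ^ N)%N.
have n0 : (0 < n)%N by rewrite expn_gt0.
apply: (@le_trans _ _ (\int[P]_w (
    (max_partial_sum (fun j => x j w) i n ^+ m.*2)%:E +
    (2%:E * (max_partial_sum (fun j => x j w) (i + n) n ^+ m.*2)%:E +
     c%:E * ((\sum_(i <= j < i + n) x j w) ^+ m.*2)%:E)))).
  apply: ge0_le_integral => //.
  - by move=> w _; rewrite lee_fin.
  - apply: emeasurable_funD => //; apply: emeasurable_funD;
    exact: emeasurable_funM.
  - move=> w _; rewrite -!EFinM -!EFinD lee_fin.
    set a := max_partial_sum _ i n; set b := max_partial_sum _ (i + n) n.
    set s := (\sum_(i <= j < i + n) x j w)%R.
    have a0 : (0 <= a)%R by exact: max_partial_sum_ge0.
    have b0 : (0 <= b)%R by exact: max_partial_sum_ge0.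
    have S0 : (0 <= s ^+ m.*2)%R by exact: s0.
    have := max_partial_sum_double (fun j => x j w) i n.
    rewrite -/a -/b -/s le_max => /orP[ha|hb].
      apply: (@le_trans _ _ (a ^+ m.*2)%R).
        by rewrite lerXn2r ?nnegrE ?max_partial_sum_ge0.
      by rewrite lerDl addr_ge0// mulr_ge0// exprn_ge0.
    apply: (@le_trans _ _ ((b + `|s|) ^+ m.*2)%R).
      by rewrite lerXn2r ?nnegrE ?max_partial_sum_ge0// addr_ge0.
    have q0 : (0 < m.*2)%N by rewrite double_gt0 ltnW.
    apply: le_trans (exprDn_le2 q0 b0 (normr_ge0 s)) _.
    by rewrite -normrX (ger0_norm S0) lerDr exprn_ge0.
rewrite ge0_integralD//; last 3 first.
- by move=> w _; rewrite lee_fin.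
- by move=> w _; rewrite adde_ge0// mule_ge0// lee_fin.
- by apply: emeasurable_funD; exact: emeasurable_funM.
rewrite ge0_integralD//; last 4 first.
- by move=> w _; rewrite mule_ge0// lee_fin.
- exact: emeasurable_funM.
- by move=> w _; rewrite mule_ge0// lee_fin.
- exact: emeasurable_funM.
rewrite !ge0_integralZl//; last 2 first.
- by move=> w _; rewrite lee_fin.
- by move=> w _; rewrite lee_fin.
apply: le_trans (leeD (IH i) (leeD (lee_wpmul2l _ (IH (i + n)%N))
  (lee_wpmul2l _ (xD i n n0)))) _; [by rewrite lee_fin..|].
rewrite -!EFinM -!EFinD lee_fin addnn -mul2n natrM exprMn.
have F : (4 <= 2 ^+ m :> R)%R.
  by rewrite (_ : 4 = 2 ^+ 2)%R ?ler_eXn2l//; lra.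
have X0 : (0 <= c * D * n%:R ^+ m)%R by rewrite !mulr_ge0// exprn_ge0.
rewrite -/n; set u := (n%:R ^+ m : R)%R in X0 *.
nra.
Qed.

(** Round [n] up to a power of two, which is at most [2 * n]. *)
Lemma maximal_inequality (x : nat -> T -> R) (m : nat) (D : R) :
  (1 < m)%N -> (0 <= D)%R -> (forall j, measurable_fun setT (x j)) ->
  (forall i k, (0 < k)%N ->
    \int[P]_w ((\sum_(i <= j < i + k) x j w) ^+ m.*2)%:E <= (D * k%:R ^+ m)%:E) ->
  forall i n, (0 < n)%N ->
  \int[P]_w (max_partial_sum (fun j => x j w) i n ^+ m.*2)%:E
    <= ((1 + (m.*2).*2%:R) ^+ m.*2 * D * (2 * n%:R) ^+ m)%:E.
Proof.
move=> m1 D0 mx xD i n n0.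
have /andP[Nn nN] := trunc_log_bounds (isT : (1 < 2)%N) n0.
set N := (trunc_log 2 n).+1 in nN.
apply: (@le_trans _ _
    (\int[P]_w (max_partial_sum (fun j => x j w) i (2 ^ N) ^+ m.*2)%:E)).
  apply: ge0_le_integral => //.
  - by move=> w _; rewrite lee_fin exprn_ge0// max_partial_sum_ge0.
  - by apply/measurable_EFinP; apply: measurable_funX; exact: measurable_max_partial_sum.
  - by apply/measurable_EFinP; apply: measurable_funX; exact: measurable_max_partial_sum.
  - move=> w _; rewrite lee_fin lerXn2r ?nnegrE ?max_partial_sum_ge0//.
    apply: max_partial_sum_le; first exact: max_partial_sum_ge0.
    by move=> k kn; apply: le_max_partial_sum; exact: leq_trans kn (ltnW nN).
apply: le_trans (dyadic_maximal_inequality m1 D0 mx xD N i) _.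
rewrite lee_fin ler_wpM2l//.
  by rewrite mulr_ge0// exprn_ge0// addr_ge0.
rewrite lerXn2r ?nnegrE ?mulr_ge0//.
by rewrite -natrM ler_nat /N expnS leq_mul2l.
Qed.

End MaximalInequality.

(** * Regularity of the solution *)

Section OdeEstimates.
Context {R : realType}.

Lemma is_derive_coord d (z : R -> 'rV[R]_d) (t : R) (v : 'rV[R]_d) i :
  is_derive t 1 z v -> is_derive t 1 (fun s => z s ord0 i) (v ord0 i).
Proof.
move=> [dz zv]; have dzi := (derivable_mxP z t 1).1 dz ord0 i.
split => //.
by have := derive_mx dz; rewrite zv => ->; rewrite mxE.
Qed.

Lemma within_continuous_coord d (A : set R) (z : R -> 'rV[R]_d) i :
  {within A, continuous z} -> {within A, continuous (fun s => z s ord0 i)}.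
Proof.
move=> cz x; have := @cvg_comp _ _ _ z (fun y : 'rV[R]_d => y ord0 i) _ _ _ (cz x).
by apply; exact: (@coord_continuous _ _ _ ord0 i (z x)).
Qed.

Lemma holder_within_continuous (A : set R) (g : R -> R) (c r : R) :
  0 < r -> (forall x y, A x -> A y -> `|g x - g y| <= c * powR `|x - y| r) ->
  {within A, continuous g}.
Proof.
move=> r0 gH; apply/subspace_continuousP => x Ax.
apply/cvgrPdist_le => e e0.
(* The maximum with 1 makes the constant positive, so that it can be divided by. *)
pose c' := Num.max c 1.
have c'0 : 0 < c' by rewrite lt_max ltr01 orbT.
have d0 : 0 < powR (e / c') r^-1 by apply: powR_gt0; exact: divr_gt0.
near=> y.
have Ay : A y by near: y; exact: withinT.
apply: le_trans (gH x y Ax Ay) _.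
apply: (@le_trans _ _ (c' * powR `|x - y| r)).
  by rewrite ler_wpM2r ?powR_ge0// le_max lexx.
rewrite mulrC -ler_pdivlMr//.
apply: (@le_trans _ _ (powR (powR (e / c') r^-1) r)); last first.
  by rewrite -powRrM mulVf ?gt_eqF// powRr1// divr_ge0 ?ltW.
rewrite ge0_ler_powR ?nnegrE ?(ltW r0) ?(ltW d0)//.
near: y; apply: cvg_within; apply/nbhs_ballP; exists (powR (e / c') r^-1) => //=.
by move=> y; rewrite -ball_normE/= => /ltW.
Unshelve. all: by end_near. Qed.

Variables (d : nat) (a b K L rho : R) (eta : 'rV[R]_d).
Variables (f : R -> 'rV[R]_d -> 'rV[R]_d) (z : R -> 'rV[R]_d).
Hypotheses (rho01 : 0 < rho <= 1) (K0 : 0 < K) (L0 : 0 < L).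
Hypotheses (fF : in_F a b K L rho eta f) (zsol : ode_solution a b eta f z).

(** The Gronwall bound for [1 + |z|^2] with growth rate [3 K]; it depends on the class only, as the
    final constant must. *)
Definition solution_bound : R := Num.sqrt ((1 + K ^+ 2) * expR (3 * K * (b - a))).

(** The slope is [f t (z t)]. The factor [d] in the Hoelder constant below arises because the
    increments of [z] are bounded coordinate by coordinate. *)
Definition slope_bound : R := K * (1 + solution_bound).

Definition slope_holder : R := L * (1 + d%:R * slope_bound).

Lemma slope_bound_ge0 : 0 <= slope_bound.
Proof. by rewrite mulr_ge0 ?(ltW K0)// addr_ge0// sqrtr_ge0. Qed.

Lemma slope_holder_gt0 : 0 < slope_holder.
Proof. by rewrite mulr_gt0// ltr_pwDl// mulr_ge0// slope_bound_ge0. Qed.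

(** The function [(1 + |z|^2) expR (- 3 K s)] is nonincreasing, since [2 <z, f> <= 2 K |z| (1 + |z|)
    <= 3 K (1 + |z|^2)]. Squaring the norm keeps it differentiable at 0. *)
Lemma ode_solution_bounded t : a <= t <= b -> enorm (z t) <= solution_bound.
Proof.
move=> /andP[at_ tb]; case: fF => etaK _ fK _ _; case: zsol => za cz dz.
pose u s := \sum_(i < d) z s ord0 i ^+ 2.
pose v s := (1 + u s) * expR (- (3 * K) * s).
have uE s : u s = enorm (z s) ^+ 2 by rewrite enorm_sqr.
pose du s := \sum_(i < d) (z s ord0 i * f s (z s) ord0 i) *+ 2.
have dv s : s \in `]a, b[ ->
    is_derive s 1 v (du s * expR (- (3 * K) * s)
      + (1 + u s) * (- (3 * K) * expR (- (3 * K) * s))).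
  rewrite in_itv/= => sab.
  have dzi i := is_derive_coord i (dz s sab).
  have du' : is_derive s 1 u (du s).
    rewrite (_ : u = \sum_(i < d) (fun s => z s ord0 i) ^+ 2); last first.
      by apply/funext => r; rewrite /u fct_sumE.
    apply: is_derive_eq; apply: eq_bigr => i _.
    by rewrite /= expr1 /GRing.scale/= -[RHS]mulr_natl mulrA.
  pose e s := expR (- (3 * K) * s).
  have de : is_derive s 1 e (- (3 * K) * e s).
    rewrite (_ : e = expR \o (- (3 * K) \*: id))//.
    apply: is_derive_eq.
    by rewrite /= /GRing.scale/= mulr1 mulrC.
  rewrite (_ : v = (cst 1 + u) * e)//.
  apply: is_derive_eq.
  by rewrite add0r /GRing.scale/= addrC mulrC.
have vle : v t <= v a.
  apply: (@ler0_derive1_nincr _ v a b) => //.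
  - by move=> s /dv sab; exact: ex_derive.
  - move=> s sab; rewrite derive1E; have := dv s sab => ?; rewrite derive_val.
    rewrite mulrA -mulrDl; apply: mulr_le0_ge0; last exact: expR_ge0.
    have : du s <= 2 * (enorm (z s) * (K * (1 + enorm (z s)))).
      rewrite /du sumrMnl -[leLHS]mulr_natl ler_pM2l//.
      apply: le_trans (enorm_cauchy_schwarz _ _) _.
      rewrite ler_wpM2l ?enorm_ge0// fK//.
      by move: sab; rewrite in_itv/= => /andP[/ltW -> /ltW ->].
    rewrite uE; move: (enorm (z s)) (du s) => e D.
    by have := mulr_ge0 (ltW K0) (sqr_ge0 (e - 1)); have := K0; nra.
  - have cu : {within `[a, b], continuous u}.
      pose g := \sum_(i < d) (fun y : 'rV[R]_d => y ord0 i ^+ 2).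
      have cg : continuous g.
        rewrite /g; elim/big_ind : _ => [|g1 g2 c1 c2|i _] y.
        - exact: (@cst_continuous _ _ (0 : R) y).
        - exact: (continuousD (c1 y) (c2 y)).
        - by apply: continuousM; exact: coord_continuous.
      have -> : u = g \o z by apply/funext => s; rewrite /g /= fct_sumE.
      by apply: within_continuous_comp cz => y _; exact: cg.
    have ce : {within `[a, b], continuous (fun s => expR (- (3 * K) * s))}.
      apply: continuous_subspaceT => s.
      apply: continuous_comp; last exact: continuous_expR.
      by apply: cvgM; [exact: cvg_cst|exact: cvg_id].
    move=> s; apply: cvgM; last exact: ce.
    by apply: cvgD; [exact: cvg_cst|exact: cu].
rewrite /solution_bound -(ler_sqr (x := enorm _)) ?nnegrE ?enorm_ge0 ?sqrtr_ge0//.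
rewrite -uE sqr_sqrtr ?mulr_ge0 ?expR_ge0 ?addr_ge0 ?sqr_ge0//.
have := ler_wpM2r (expR_ge0 (3 * K * t)) vle; rewrite /v.
rewrite -[X in X <= _]mulrA -[X in _ <= X]mulrA -!expRD mulNr addNr expR0 mulr1 => H.
apply: (@le_trans _ _ (1 + u t)); first by rewrite lerDr.
apply: le_trans H _.
have -> : - (3 * K) * a + 3 * K * t = 3 * K * (t - a) by ring.
rewrite ler_pM ?addr_ge0 ?expR_ge0 ?lerD2l ?ler_expR ?ler_wpM2l ?lerB ?mulr_ge0 ?(ltW K0)//.
  by rewrite uE sqr_ge0.
by rewrite uE za lerXn2r ?nnegrE ?enorm_ge0 ?(ltW K0).
Qed.

(** The mean value theorem as an equality is a scalar fact, so the intermediate point depends on the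
    coordinate. *)
Lemma ode_coord_mvt i s t : a <= s -> s <= t -> t <= b ->
  exists2 c, s <= c <= t & z t ord0 i - z s ord0 i = f c (z c) ord0 i * (t - s).
Proof.
move=> as_ st tb; case: zsol => za cz dz.
have [||c] := @MVT_segment _ (fun s => z s ord0 i) (fun s => f s (z s) ord0 i) s t st.
- move=> x; rewrite in_itv/= => /andP[sx xt]; apply: is_derive_coord; apply: dz.
  by rewrite (le_lt_trans as_)//= (lt_le_trans xt).
- apply: within_continuous_coord; apply: continuous_subspaceW cz.
  by move=> x; rewrite /= !in_itv/= => /andP[sx xt]; rewrite (le_trans as_)//= (le_trans xt).
by rewrite in_itv/= => cst_ zE; exists c.
Qed.

Lemma slope_le s : a <= s <= b -> enorm (f s (z s)) <= slope_bound.
Proof.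
move=> sab; case: fF => _ _ fK _ _; apply: le_trans (fK _ _ sab) _.
by rewrite ler_wpM2l ?(ltW K0)// lerD2l ode_solution_bounded.
Qed.

Lemma ode_coord_lipschitz i s t : a <= s <= b -> a <= t <= b ->
  `|z t ord0 i - z s ord0 i| <= slope_bound * `|t - s|.
Proof.
wlog st : s t / s <= t => [H|] sab tab.
  by have [st|/ltW ts] := leP s t; [exact: H|rewrite distrC (distrC t); exact: H].
move: (sab) (tab) => /andP[as_ sb] /andP[at_ tb].
have [c /andP[sc ct] ->] := ode_coord_mvt i as_ st tb.
rewrite normrM ler_wpM2r// (le_trans (coord_le_enorm _ _))// slope_le//.
by rewrite (le_trans as_)//= (le_trans ct).
Qed.

(** Change the time argument first and the space argument second; the Lipschitz term in [|t - s|] is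
    absorbed by its power [rho] because [|t - s| <= 1]. *)
Lemma slope_is_holder s t : a <= s <= b -> a <= t <= b -> `|t - s| <= 1 ->
  enorm (f t (z t) - f s (z s)) <= slope_holder * powR `|t - s| rho.
Proof.
move=> sab tab ts1; case: fF => _ _ _ fT fX; case/andP: rho01 => r0 r1.
have -> : f t (z t) - f s (z s) = (f t (z t) - f s (z t)) + (f s (z t) - f s (z s)).
  by rewrite addrA subrK.
apply: le_trans (enormD _ _) _.
apply: le_trans (lerD (fT _ _ _ tab sab) (fX _ _ _ sab)) _.
rewrite -mulrDr /slope_holder -mulrA ler_wpM2l ?(ltW L0)// mulrDl mul1r lerD2l.
apply: (@le_trans _ _ (d%:R * (slope_bound * `|t - s|))).
  apply: le_trans (enorm_le_sum _) _.
  rewrite mulr_natl -[X in _ *+ X]card_ord -sumr_const ler_sum// => i _.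
  by rewrite !mxE ode_coord_lipschitz.
rewrite mulrA ler_wpM2l//; first by rewrite mulr_ge0// slope_bound_ge0.
have [->|ts0] := eqVneq `|t - s| 0; first by rewrite powR_ge0.
by rewrite ger1_powR// ts1 andbT lt_def ts0 normr_ge0.
Qed.

(** The mean value point and [c] are at most [h] apart. An arbitrary [c] serves two uses: the random
    node of a full step, and the right endpoint in the implicit stage. *)
Lemma ode_coord_increment i s t c h : a <= s -> t <= b -> s <= c <= t ->
  t - s <= h -> h <= 1 ->
  `|z t ord0 i - z s ord0 i - (t - s) * f c (z c) ord0 i|
    <= slope_holder * (h * powR h rho).
Proof.
move=> as_ tb /andP[sc ct] tsh h1; have st := le_trans sc ct.
case/andP: rho01 => r0 r1.
have [x /andP[sx xt] ->] := ode_coord_mvt i as_ st tb.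
rewrite mulrC -mulrBr normrM mulrCA ler_pM//; first by rewrite ger0_norm// subr_ge0.
have xch : `|x - c| <= h.
  by rewrite ler_norml; apply/andP; split; lra.
have := coord_le_enorm (f x (z x) - f c (z c)) i; rewrite !mxE => /le_trans; apply.
apply: le_trans (slope_is_holder _ _ _) _.
- by rewrite (le_trans as_)//= (le_trans ct).
- by rewrite (le_trans as_)//= (le_trans xt).
- exact: le_trans h1.
rewrite ler_wpM2l ?(ltW slope_holder_gt0)//.
by rewrite ge0_ler_powR ?nnegrE ?(ltW r0)// (le_trans _ xch).
Qed.

End OdeEstimates.

(** * Pathwise error bound *)

(** The induction bounds the right-hand side of the hypothesis, which grows by at most the factor
    [1 + c] per step. *)
Lemma discrete_gronwall {R : realType} (e : nat -> R) (A c : R) (n : nat) :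
  0 <= c ->
  (forall k, (k <= n)%N -> e k <= A + c * \sum_(j < k) e j) ->
  forall k, (k <= n)%N -> e k <= A * (1 + c) ^+ k.
Proof.
move=> c0 He k kn; apply: le_trans (He k kn) _.
elim: k kn => [_|k IH kn]; first by rewrite big_ord0 mulr0 addr0 expr0 mulr1.
rewrite big_ord_recr/= mulrDr addrA exprSr mulrA mulrDr mulr1.
have IHk := IH (ltnW kn).
rewrite lerD// mulrC ler_wpM2r//.
exact: le_trans (He k (ltnW kn)) IHk.
Qed.

(** The error of one-point quadrature for the integral of the slope over [[s, s + h]], with
    evaluation point [s + h * u]. *)
Definition quadrature_residual {R : realType} {d : nat}
    (f : R -> 'rV[R]_d -> 'rV[R]_d) (z : R -> 'rV[R]_d) (s h u : R) : 'rV[R]_d :=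
  z (s + h) - z s - h *: f (s + h * u) (z (s + h * u)).

Section PathwiseError.
Context {R : realType}.
Variables (d : nat) (a b K L rho : R) (eta : 'rV[R]_d).
Variables (f : R -> 'rV[R]_d -> 'rV[R]_d) (z : R -> 'rV[R]_d).
Hypotheses (rho01 : 0 < rho <= 1) (K0 : 0 < K) (L0 : 0 < L).
Hypotheses (fF : in_F a b K L rho eta f) (zsol : ode_solution a b eta f z).
Variables (n : nat) (h q : R) (tau : nat -> R).
Hypotheses (hn : h * n%:R = b - a) (h0 : 0 < h) (h1 : h <= 1).
Hypotheses (Lhq : L * h <= q) (q1 : q < 1) (tau01 : forall j, 0 <= tau j <= 1).

Let H := slope_holder d a b K L.
Let V := schemeS1 a h eta f tau.
Let node (j : nat) := a + j%:R * h.
(** Shifted indexing: [theta j] and [Vt j] belong to the step from [node j] to [node j.+1], hence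
    the use of [tau j.+1]. *)
Let theta (j : nat) := node j + h * tau j.+1.
Let Vt (j : nat) := implicit_sol f (theta j) (tau j.+1 * h) (V j).
Let e (j : nat) := enorm (z (node j) - V j).

(** [D] bounds the local error of a step in Euclidean norm; [Lam] is the Lipschitz constant [L]
    amplified by the implicit solve. *)
Let D := d%:R * (H * (h * powR h rho)).
Let Lam := L / (1 - q).

Let q_lt1 : 0 < 1 - q. Proof. by rewrite subr_gt0. Qed.

Let H0 : 0 < H. Proof. exact: slope_holder_gt0. Qed.

Let D0 : 0 <= D.
Proof.
apply: mulr_ge0 => //; apply: mulr_ge0; first exact: ltW.
by apply: mulr_ge0; [exact: ltW|exact: powR_ge0].
Qed.

Let nodeS j : node j.+1 = node j + h.
Proof. by rewrite /node -natr1 mulrDl mul1r addrA. Qed.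

Let node_ge j : a <= node j.
Proof. by rewrite lerDl mulr_ge0// ltW. Qed.

Let node_le j : (j <= n)%N -> node j <= b.
Proof.
move=> jn; rewrite -lerBrDl -hn mulrC ler_wpM2l ?(ltW h0)//.
by rewrite ler_nat.
Qed.

Let theta_bounds j : node j <= theta j <= node j.+1.
Proof.
have /andP[t0 t1] := tau01 j.+1.
by rewrite nodeS lerDl mulr_ge0 ?(ltW h0)//= lerD2l ler_piMr ?(ltW h0).
Qed.

Let theta_itv j : (j < n)%N -> a <= theta j <= b.
Proof.
move=> jn; have /andP[t0 t1] := theta_bounds j.
by rewrite (le_trans (node_ge j))//= (le_trans t1)// node_le.
Qed.

Let tau_step j : 0 <= tau j.+1 * h /\ L * (tau j.+1 * h) <= q.
Proof.
have /andP[t0 t1] := tau01 j.+1; split; first by rewrite mulr_ge0// ltW.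
by apply: le_trans Lhq; rewrite ler_wpM2l ?(ltW L0)// ler_piMl ?(ltW h0).
Qed.

(** [xget] returns its default 0 unless a solution exists; the contraction with factor [L * c]
    supplies one. *)
Lemma implicit_sol_fixpoint t c x : a <= t <= b -> 0 <= c -> L * c < 1 ->
  implicit_sol f t c x = x + c *: f t (implicit_sol f t c x).
Proof.
move=> tab c0 Lc; case: fF => _ _ _ _ fX.
have [|||y yE] := @enorm_contraction_fixpoint _ _ (fun y => x + c *: f t y) (L * c).
- by rewrite mulr_ge0// ltW.
- exact: Lc.
- move=> y1 y2; rewrite opprD addrACA subrr add0r -scalerBr enormZ ger0_norm//.
  by rewrite (mulrC L) -mulrA ler_wpM2l// fX.
exact: (@xgetPex _ 0 [set y | y = x + c *: f t y] (ex_intro _ y yE)).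
Qed.

Let stageE j : (j < n)%N -> Vt j = V j + (tau j.+1 * h) *: f (theta j) (Vt j).
Proof.
move=> jn; have [c0 cq] := tau_step j.
by apply: implicit_sol_fixpoint; [exact: theta_itv|exact: c0|exact: le_lt_trans cq q1].
Qed.

(** Up to a remainder of norm at most [D], the solution satisfies the implicit Euler relation at
    [theta j]. Subtracting the stage equation leaves [q * E] on the right, which is absorbed since
    [q < 1]. *)
Let stage_error j : (j < n)%N ->
  enorm (z (theta j) - Vt j) <= (1 - q)^-1 * (e j + D).
Proof.
move=> jn; case: fF => _ _ _ _ fX; have [c0 cq] := tau_step j.
set E := enorm _.
have /andP[s1 s2] := theta_bounds j.
have ts : theta j - node j = tau j.+1 * h by rewrite /theta addrC addKr mulrC.
pose r := z (theta j) - z (node j) - (theta j - node j) *: f (theta j) (z (theta j)).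
have rD : enorm r <= D.
  apply: le_trans (enorm_le_sum _) _.
  rewrite /D mulr_natl -[X in _ *+ X]card_ord -sumr_const ler_sum// => i _.
  rewrite !mxE; apply: (ode_coord_increment (eta := eta)) => //.
  - by have /andP[] := theta_itv jn.
  - by rewrite s1 lexx.
  - by rewrite lerBlDl -nodeS.
have zV : z (theta j) - Vt j = (z (node j) - V j) + r +
    (tau j.+1 * h) *: (f (theta j) (z (theta j)) - f (theta j) (Vt j)).
  rewrite {1}(stageE jn) /r ts scalerBr; apply/rowP => i; rewrite !mxE; ring.
have : E <= e j + D + q * E.
  rewrite /E zV; apply: le_trans (enormD _ _) _; rewrite -zV -/E lerD//.
    by apply: le_trans (enormD _ _) _; rewrite lerD2l.
  rewrite enormZ ger0_norm//.
  apply: le_trans (ler_wpM2l c0 (fX _ _ _ (theta_itv jn))) _.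
  by rewrite mulrA ler_wpM2r ?enorm_ge0// mulrC.
by move=> EE; rewrite mulrC ler_pdivlMr//; lra.
Qed.

(** The residuals stay a signed sum, so that their stochastic cancellation is preserved; only the
    difference of slopes is estimated in norm. *)
Let error_decomposition k : (k <= n)%N -> exists2 r : 'rV[R]_d,
  z (node k) - V k =
    \sum_(1 <= j < 1 + k) quadrature_residual f z (node j.-1) h (tau j) + r &
  enorm r <= \sum_(j < k) h * (Lam * (e j + D)).
Proof.
elim: k => [_|k IH kn].
  exists 0; last by rewrite big_ord0 -(scale0r 0) enormZ normr0 mul0r.
  case: zsol => za _ _.
  by rewrite big_geq// addr0 /node mul0r addr0 za subrr.
have [r rE rle] := IH (ltnW kn).
exists (r + h *: (f (theta k) (z (theta k)) - f (theta k) (Vt k))).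
  have -> : V k.+1 = V k + h *: f (theta k) (Vt k) by [].
  rewrite addnS big_nat_recr//= add1n/= nodeS /quadrature_residual -/(theta k).
  rewrite [RHS]addrACA -rE scalerBr; apply/rowP => i; rewrite !mxE; ring.
apply: le_trans (enormD _ _) _; rewrite big_ord_recr/= lerD//.
rewrite enormZ gtr0_norm// ler_wpM2l ?(ltW h0)//.
case: fF => _ _ _ _ fX.
apply: le_trans (fX _ _ _ (theta_itv kn)) _.
by rewrite /Lam -mulrA ler_wpM2l ?(ltW L0)// stage_error.
Qed.

(** Gronwall applied to the decomposition: the terms [h * Lam * D] of at most [n] steps add up to
    the second summand, since [h * n = b - a]. *)
Lemma scheme_error_le k : (k <= n)%N ->
  enorm (z (a + k%:R * h) - schemeS1 a h eta f tau k) <=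
  expR (L / (1 - q) * (b - a)) *
  (\sum_(i < d) max_partial_sum (fun j => quadrature_residual f z
       (a + j.-1%:R * h) h (tau j) ord0 i) 1 n
   + L / (1 - q) * (b - a) * (d%:R * (slope_holder d a b K L * (h * powR h rho)))).
Proof.
move=> kn; rewrite -/H -/D -/Lam.
set Q := \sum_(i < d) _.
have Lam0 : 0 <= Lam by rewrite mulr_ge0 ?invr_ge0 ?ltW.
have hL0 : 0 <= h * Lam by rewrite mulr_ge0// ltW.
have ba0 : 0 <= b - a by rewrite -hn mulr_ge0// ltW.
have Q0 : 0 <= Q by rewrite sumr_ge0// => i _; exact: max_partial_sum_ge0.
have A0 : 0 <= Q + Lam * (b - a) * D.
  by apply: addr_ge0 => //; apply: mulr_ge0 => //; exact: mulr_ge0.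
have He m : (m <= n)%N -> e m <= Q + Lam * (b - a) * D + h * Lam * \sum_(j < m) e j.
  move=> mn; have [r rE rle] := error_decomposition mn.
  rewrite /e rE; apply: le_trans (enormD _ _) _; rewrite -addrA; apply: lerD.
    apply: le_trans (enorm_le_sum _) _; apply: ler_sum => i _.
    by rewrite summxE; exact: (@le_max_partial_sum _ (fun j =>
      quadrature_residual f z (node j.-1) h (tau j) ord0 i) 1 n m).
  apply: le_trans rle _.
  under eq_bigr do rewrite mulrA mulrDr.
  rewrite big_split/= -mulr_sumr addrC lerD2r sumr_const card_ord.
  have -> : h * Lam * D *+ m = Lam * (h * m%:R) * D by rewrite -[LHS]mulr_natl; ring.
  by rewrite ler_wpM2r// ler_wpM2l// -hn ler_wpM2l ?(ltW h0)// ler_nat.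
apply: le_trans (discrete_gronwall hL0 He kn) _.
rewrite mulrC ler_wpM2r//.
(* [(1 + h Lam)^k <= expR (k h Lam) <= expR (Lam (b - a))], uniformly in [n]. *)
apply: (@le_trans _ _ (expR (h * Lam) ^+ k)).
  by rewrite lerXn2r ?nnegrE ?expR_ge0 ?addr_ge0 ?expR_ge1Dx.
rewrite -expRM_natl ler_expR -hn.
have -> : k%:R * (h * Lam) = Lam * (h * k%:R) by ring.
by rewrite ler_wpM2l// ler_wpM2l ?(ltW h0)// ler_nat.
Qed.

End PathwiseError.

(** * Residuals as random variables *)

Section Residuals.
Context {R : realType}.

(** The residual is controlled for [u] in [[0, 1]] only, whereas the moment bounds take globally
    bounded functions of [tau]; clamping changes nothing almost surely and preserves continuity. *)
Definition clamp01 (u : R) : R := Num.max 0 (Num.min 1 u).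

Lemma clamp01_itv u : 0 <= clamp01 u <= 1.
Proof. by rewrite /clamp01 le_max lexx/= ge_max ler01 ge_min lexx. Qed.

Lemma clamp01_id u : 0 <= u <= 1 -> clamp01 u = u.
Proof. by move=> /andP[u0 u1]; rewrite /clamp01 (min_idPr u1) (max_idPr u0). Qed.

Lemma clamp01_lipschitz u v : `|clamp01 u - clamp01 v| <= `|u - v|.
Proof.
wlog vu : u v / v <= u => [H|].
  by have [vu|/ltW uv] := leP v u; [exact: H|rewrite distrC (distrC u); exact: H].
have cl_le : clamp01 v <= clamp01 u.
  by rewrite /clamp01 ge_max !le_max lexx/= orbC le_min !ge_min lexx/= vu orbT.
rewrite !ger0_norm ?subr_ge0//.
have m01 : Num.max 0 1 = 1 :> R by exact/max_idPr.
by rewrite /clamp01; case: (leP 1 u) => u1; case: (leP 1 v) => v1;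
  rewrite ?m01; case: (leP 0 u) => w0; case: (leP 0 v) => w1; lra.
Qed.

(** The event that [X] lies outside [[0, 1]] is null, and on subsets of [[0, 1]] the law of [X] is
    Lebesgue measure. *)
Lemma integral_uniform01 {dT : measure_display} {T : measurableType dT}
    (P : probability T R) (X : T -> R) (g : R -> R) (M : R) :
  uniform01_rv P X -> measurable_fun setT g -> (forall x, `|g x| <= M) ->
  (\int[P]_w (g (X w))%:E = \int[lebesgue_measure]_(x in `[0%R, 1%R]) (g x)%:E)%E.
Proof.
move=> [mX PX] mg gM.
have mI : measurable (X @^-1` `[0, 1]).
  by rewrite -[X in measurable X]setTI; exact: mX.
have ig := integrable_bounded_comp P mX mg gM.
have igI : P.-integrable (X @^-1` `[0, 1]) (fun w => (g (X w))%:E).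
  exact: integrableS ig.
rewrite (@negligible_integral _ _ _ P setT (~` (X @^-1` `[0, 1])))//; last 2 first.
- exact: measurableC.
- rewrite preimage_setC; apply: etrans (PX _ _) _; first exact: measurableC.
  by rewrite setICl measure0.
rewrite setDE setCK setTI.
have mX' : measurable_fun setT (X : T -> measurableTypeR R) := mX.
pose X' : {mfun T >-> measurableTypeR R} := HB.pack (X : T -> measurableTypeR R)
  (isMeasurableFun.Build _ _ _ _ (X : T -> measurableTypeR R) mX').
have -> : (\int[P]_(w in X @^-1` `[0%R, 1%R]) (g (X w))%:E =
    \int[pushforward P X']_(x in `[0%R, 1%R]) (g x)%:E)%E.
  by rewrite integral_pushforward//; exact/measurable_EFinP.
apply: (@eq_measure_integral _ (measurableTypeR R) R _ lebesgue_measure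
  (pushforward P X')) => A mA AI.
by apply: etrans (PX A mA) _; rewrite (setIidl AI).
Qed.

Variables (d : nat) (a b K L rho : R) (eta : 'rV[R]_d).
Variables (f : R -> 'rV[R]_d -> 'rV[R]_d) (z : R -> 'rV[R]_d).
Hypotheses (rho01 : 0 < rho <= 1) (K0 : 0 < K) (L0 : 0 < L).
Hypotheses (fF : in_F a b K L rho eta f) (zsol : ode_solution a b eta f z).
Variables (s h : R) (i : 'I_d).
Hypotheses (h0 : 0 < h) (h1 : h <= 1) (as_ : a <= s) (sb : s + h <= b).

Let g (u : R) : R := quadrature_residual f z s h (clamp01 u) ord0 i.

Let pt_itv (u : R) : 0 <= u <= 1 -> a <= s + h * u <= b.
Proof.
move=> /andP[u0 u1]; rewrite (le_trans as_) ?lerDl ?mulr_ge0 ?(ltW h0)//=.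
by rewrite (le_trans _ sb)// lerD2l ler_piMr// ltW.
Qed.

Lemma residual_bounded u : `|g u| <= slope_holder d a b K L * (h * powR h rho).
Proof.
have /andP[u0 u1] := clamp01_itv u.
rewrite /g /quadrature_residual !mxE.
have := @ode_coord_increment _ d a b K L rho eta f z rho01 K0 L0 fF zsol i
  s (s + h) (s + h * clamp01 u) h.
have -> : s + h - s = h by ring.
apply => //.
by rewrite lerDl mulr_ge0 ?(ltW h0)//= lerD2l ler_piMr ?(ltW h0).
Qed.

(** Serves to make the clamped residual continuous in [u], hence measurable and within reach of the
    fundamental theorem of calculus. *)
Lemma residual_holder u v :
  `|g u - g v| <= slope_holder d a b K L * powR `|u - v| rho.
Proof.
have [r0 r1] := andP rho01.
rewrite /g /quadrature_residual !mxE.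
set pu := s + h * clamp01 u; set pv := s + h * clamp01 v.
have -> (x y w : R) : x - h * y - (x - h * w) = h * (w - y) by ring.
rewrite normrM gtr0_norm//.
have puv : `|pv - pu| <= `|u - v|.
  rewrite /pu /pv.
  have -> : s + h * clamp01 v - (s + h * clamp01 u) = h * (clamp01 v - clamp01 u) by ring.
  rewrite normrM gtr0_norm// distrC.
  apply: le_trans (clamp01_lipschitz u v).
  by rewrite ler_piMl.
have puv1 : `|pv - pu| <= 1.
  have /andP[u0 u1] := clamp01_itv u; have /andP[v0 v1] := clamp01_itv v.
  have -> : pv - pu = h * (clamp01 v - clamp01 u) by rewrite /pu /pv; ring.
  rewrite normrM gtr0_norm// mulr_ile1 ?(ltW h0)//.
  by rewrite ler_norml; apply/andP; split; lra.
have := @slope_is_holder _ d a b K L rho eta f z rho01 K0 L0 fF zsol pu pv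
  (pt_itv (clamp01_itv u)) (pt_itv (clamp01_itv v)) puv1.
move=> Hh.
have := coord_le_enorm (f pv (z pv) - f pu (z pu)) i; rewrite !mxE => H1.
have H2 := le_trans H1 Hh.
apply: (@le_trans _ _ `|f pv (z pv) ord0 i - f pu (z pu) ord0 i|).
  by rewrite ler_piMl.
apply: le_trans H2 _.
rewrite ler_wpM2l ?(ltW (slope_holder_gt0 _ _ _ _ _))//.
by rewrite ge0_ler_powR ?nnegrE ?(ltW r0).
Qed.

Lemma residual_continuous : continuous g.
Proof.
have [r0 r1] := andP rho01.
apply/continuous_subspace_setT.
by apply: (@holder_within_continuous _ _ _ _ rho) => // u v _ _; exact: residual_holder.
Qed.

(** The residual has the antiderivative [G], and [G 1 = G 0]: this is why a uniform node gives
    centred residuals. *)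
Lemma residual_integral0 : (\int[lebesgue_measure]_(x in `[0%R, 1%R]) (g x)%:E = 0)%E.
Proof.
pose Dz := z (s + h) ord0 i - z s ord0 i.
pose G (u : R) : R := u * Dz - z (s + h * u) ord0 i.
case: (zsol) => _ _ dz.
have dG (u : R) : u \in `]0, 1[ -> is_derive u 1 G (g u).
  rewrite in_itv/= => /andP[u0 u1].
  have du : is_derive (s + h * u) 1 (fun t => z t ord0 i)
      (f (s + h * u) (z (s + h * u)) ord0 i).
    apply: is_derive_coord; apply: dz.
    rewrite (le_lt_trans as_) ?ltrDl ?mulr_gt0//=.
    by rewrite (lt_le_trans _ sb)// ltrD2l gtr_pMr.
  have da : is_derive u 1 (cst s + h \*: id) h.
    by apply: is_derive_eq; rewrite add0r /GRing.scale/= mulr1.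
  rewrite (_ : G = (Dz \*: id) - ((fun t => z t ord0 i) \o (cst s + h \*: id))); last first.
    by apply/funext => v; rewrite /G mulrC.
  apply: is_derive_eq.
  rewrite /g clamp01_id ?(ltW u0) ?(ltW u1)// /quadrature_residual !mxE /GRing.scale/=.
  by rewrite /Dz; ring.
(* The differential equation is given on the open interval only, so continuity up to the endpoints
   comes from the Lipschitz bound on [z]. *)
have cG : {within `[0, 1], continuous G}.
  apply: (@holder_within_continuous _ _ _ (`|Dz| + slope_bound a b K) 1) => // u v.
  rewrite /= !in_itv/= => u01 v01; rewrite powRr1//.
  have -> : G u - G v = (u - v) * Dz + (z (s + h * v) ord0 i - z (s + h * u) ord0 i).
    by rewrite /G; ring.
  apply: le_trans (ler_normD _ _) _; rewrite normrM mulrDl mulrC lerD2l.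
  apply: le_trans (ode_coord_lipschitz K0 fF zsol _ _ _) _; [exact: pt_itv|exact: pt_itv|].
  rewrite ler_wpM2l ?slope_bound_ge0//.
  have -> : s + h * v - (s + h * u) = h * (v - u) by ring.
  by rewrite normrM gtr0_norm// distrC ler_piMl.
have [c1 c2 c3] := (continuous_within_itvP G ltr01).1 cG.
rewrite (@continuous_FTC2 _ g G 0 1)//.
- rewrite -EFinB /G mul1r mul0r mulr1 mulr0 addr0 /Dz; congr EFin; ring.
- by apply: continuous_subspaceT; exact: residual_continuous.
- by split => // u /dG ?; exact: ex_derive.
- by move=> u /dG ?; rewrite derive1E derive_val.
Qed.

End Residuals.

(** * Comparison of integrals off a null set *)

Section LowerIntegral.
Import HBNNSimple.

(* [f1] need not be measurable: the integral of a nonnegative function is the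
   supremum of the integrals of the simple functions below it. *)
Lemma ae_le_integral_majorant {R : realType} {dT : measure_display}
    {T : measurableType dT} (mu : {measure set T -> \bar R})
    (f1 f2 : T -> \bar R) (N : set T) :
  (forall w, 0 <= f1 w)%E -> (forall w, 0 <= f2 w)%E ->
  measurable_fun setT f2 -> mu.-negligible N ->
  (forall w, ~ N w -> f1 w <= f2 w)%E ->
  (\int[mu]_w f1 w <= \int[mu]_w f2 w)%E.
Proof.
move=> f10 f20 mf2 [A [mA A0 NA]] f12; rewrite ge0_integralTE//.
apply: ge_ereal_sup => _ [s sf1 <-].
rewrite -integralT_nnsfun; apply: ae_ge0_le_integral => //.
- by move=> w _; rewrite lee_fin.
- exact/measurable_EFinP.
- exists A; split => // w /= H; apply: NA; apply: contrapT => Nw; apply: H => _.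
  exact: le_trans (sf1 w) (f12 w Nw).
Qed.

End LowerIntegral.

(** * Elementary inequalities for powers *)

Section PowerSums.
Context {R : realType}.

Lemma exprD_le (q : nat) (x y : R) : 0 <= x -> 0 <= y ->
  (x + y) ^+ q <= 2 ^+ q * (x ^+ q + y ^+ q).
Proof.
move=> x0 y0.
wlog xy : x y x0 y0 / x <= y => [H|].
  have [xy|/ltW yx] := leP x y; first exact: H.
  by rewrite (addrC x) (addrC (x ^+ q)); exact: H.
apply: (@le_trans _ _ ((2 * y) ^+ q)).
  by rewrite lerXn2r ?nnegrE ?addr_ge0 ?mulr_ge0//; lra.
by rewrite exprMn ler_wpM2l ?exprn_ge0// lerDr exprn_ge0.
Qed.

Lemma expr_sum_le (q k : nat) (x : 'I_k -> R) : (0 < q)%N ->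
  (forall i, 0 <= x i) ->
  (\sum_(i < k) x i) ^+ q <= (2 ^+ q) ^+ k * \sum_(i < k) x i ^+ q.
Proof.
move=> q0; elim: k x => [|k IH] x x0.
  by rewrite !big_ord0 mulr0 expr0n gtn_eqF.
rewrite !big_ord_recr/=.
have S0 : 0 <= \sum_(i < k) x (widen_ord (leqnSn k) i) by rewrite sumr_ge0.
have P0 : 1 <= (2 ^+ q) ^+ k :> R by rewrite !exprn_ege1// ler1n.
apply: le_trans (exprD_le q S0 (x0 ord_max)) _.
rewrite exprS -mulrA ler_wpM2l ?exprn_ge0// mulrDr lerD//; first exact: IH.
by rewrite ler_peMl// exprn_ge0.
Qed.

(** Passes from a real exponent to an integer one, for which moments are available; the summand 1
    covers [x < 1]. *)
Lemma powR_le_add1_exprn (q : nat) (p x : R) : 0 <= x -> 0 <= p -> p <= q%:R ->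
  powR x p <= 1 + x ^+ q.
Proof.
move=> x0 p0 pq; have [x1|x1] := leP 1 x.
  rewrite -powR_mulrn//; apply: (@le_trans _ _ (powR x q%:R)); first exact: ler_powR.
  by rewrite lerDr.
apply: (@le_trans _ _ 1); last by rewrite lerDl exprn_ge0.
have <- : powR 1 p = 1 :> R by rewrite powR1.
by rewrite ge0_ler_powR// ?nnegrE// ltW.
Qed.

End PowerSums.

(** * Moments of the maximal residual sums *)

Section ResidualMaxima.
Context {R : realType} {dT : measure_display} {T : measurableType dT}.
Variables (P : probability T R) (tau : nat -> T -> R).
Hypotheses (tauU : forall i, uniform01_rv P (tau i))
  (tauI : mutually_independent P tau).
Variables (d : nat) (a b K L rho : R) (eta : 'rV[R]_d).
Variables (f : R -> 'rV[R]_d -> 'rV[R]_d) (z : R -> 'rV[R]_d).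
Hypotheses (rho01 : 0 < rho <= 1) (K0 : 0 < K) (L0 : 0 < L).
Hypotheses (fF : in_F a b K L rho eta f) (zsol : ode_solution a b eta f z).
Variables (n : nat) (h : R).
Hypotheses (n0 : (0 < n)%N) (hn : h * n%:R = b - a) (h0 : 0 < h) (h1 : h <= 1).

(* Padded with zeros, so that dyadic blocks may run past the last step. *)
Definition padded_residual (i : 'I_d) (j : nat) (u : R) : R :=
  if (0 < j <= n)%N then
    quadrature_residual f z (a + j.-1%:R * h) h (clamp01 u) ord0 i
  else 0.

Let M := slope_holder d a b K L * (h * powR h rho).

Let M0 : 0 < M.
Proof.
apply: mulr_gt0; first exact: slope_holder_gt0.
by apply: mulr_gt0 => //; exact: powR_gt0.
Qed.

Let step_itv j : (0 < j <= n)%N -> a <= a + j.-1%:R * h /\ a + j.-1%:R * h + h <= b.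
Proof.
case: j => // j /= jn; split; first by rewrite lerDl mulr_ge0// ltW.
have -> : a + j%:R * h + h = a + h * j.+1%:R by rewrite -natr1; ring.
by rewrite -lerBrDl -hn ler_wpM2l ?(ltW h0)// ler_nat.
Qed.

Let padded_bounded i j u : `|padded_residual i j u| <= M.
Proof.
rewrite /padded_residual; case: ifPn => [jn|_]; last by rewrite normr0 ltW.
have [s1 s2] := step_itv jn.
exact: (@residual_bounded _ _ _ _ _ _ _ eta).
Qed.

Let padded_measurable i j : measurable_fun setT (padded_residual i j).
Proof.
have [jn|jn] := boolP (0 < j <= n)%N; rewrite /padded_residual; last first.
  by rewrite (negbTE jn).
rewrite jn; have [s1 s2] := step_itv jn.
apply: continuous_measurable_fun.
exact: (@residual_continuous _ _ a b K L rho eta).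
Qed.

Let padded_mean0 i j : (\int[P]_w (padded_residual i j (tau j w))%:E = 0)%E.
Proof.
rewrite (integral_uniform01 (tauU j) (padded_measurable i j) (padded_bounded i j)).
have [jn|jn] := boolP (0 < j <= n)%N; rewrite /padded_residual; last first.
  by rewrite (negbTE jn) integral0.
rewrite jn; have [s1 s2] := step_itv jn.
exact: (@residual_integral0 _ _ a b K L rho eta).
Qed.

Lemma measurable_max_residual_sum i : measurable_fun setT
  (fun w => max_partial_sum (fun j => padded_residual i j (tau j w)) 1 n).
Proof.
apply: (@measurable_max_partial_sum _ _ _ (fun j w => padded_residual i j (tau j w))) => j.
by apply: measurableT_comp => //; case: (tauU j).
Qed.

(** The first factor comes from the maximal inequality, the second from exponential moments; 8 is
    the 4 of [4 * M ^+ 2] times the 2 lost in rounding [n] up to a power of two. *)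
Definition residual_moment_const (m : nat) : R :=
  (1 + (m.*2).*2%:R) ^+ m.*2 * ((m.*2)`!%:R * (expR 2^-1 *+ 2)) * 8 ^+ m.

Lemma residual_moment_const_ge0 m : 0 <= residual_moment_const m.
Proof. by rewrite !mulr_ge0 ?exprn_ge0 ?addr_ge0 ?mulrn_wge0 ?expR_ge0. Qed.

(** The even-moment bound on every block of indices feeds the maximal inequality;
    [M * Num.sqrt n%:R] is the natural size of a sum of [n] independent centred terms bounded by
    [M]. *)
Lemma residual_max_moment (m : nat) i : (1 < m)%N ->
  (\int[P]_w (max_partial_sum (fun j => padded_residual i j (tau j w)) 1 n ^+ m.*2)%:E
   <= (residual_moment_const m * (M * Num.sqrt n%:R) ^+ m.*2)%:E)%E.
Proof.
move=> m1.
have mtau j : measurable_fun setT (tau j) by case: (tauU j).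
pose D : R := (m.*2)`!%:R * (expR 2^-1 *+ 2) * (4 * M ^+ 2) ^+ m.
have D0 : 0 <= D.
  rewrite !mulr_ge0 ?mulrn_wge0 ?expR_ge0 ?exprn_ge0//.
  by rewrite mulr_ge0// sqr_ge0.
apply: le_trans (@maximal_inequality _ _ _ P
  (fun j w => padded_residual i j (tau j w)) m D m1 D0 _ _ 1 n n0) _.
- by move=> j; exact: measurableT_comp.
- move=> k l l0.
  have := @integral_sum_exprn_le _ _ _ P tau (padded_residual i) M
    (index_iota k (k + l)) m mtau tauI (iota_uniq _ _) (padded_measurable i) M0
    (padded_bounded i) (padded_mean0 i).
  rewrite size_iota addKn => /(_ l0) /le_trans; apply.
  by rewrite lee_fin /D -[leRHS]mulrA -exprMn.
- have -> : (M * Num.sqrt n%:R) ^+ m.*2 = (M ^+ 2 * n%:R) ^+ m.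
    by rewrite -mul2n exprM [(M * _) ^+ 2]exprMn sqr_sqrtr.
  rewrite lee_fin /D /residual_moment_const -[leRHS]mulrA le_eqVlt; apply/orP; left; apply/eqP.
  have -> : 8 ^+ m * (M ^+ 2 * n%:R) ^+ m = (4 * M ^+ 2) ^+ m * (2 * n%:R) ^+ m.
    by rewrite -[LHS]exprMn -[RHS]exprMn; congr (_ ^+ m); ring.
  by ring.
Qed.

End ResidualMaxima.

(** * Moments of the error *)

Section ErrorMoment.
Context {R : realType} {dT : measure_display} {T : measurableType dT}.
Variables (P : probability T R) (tau : nat -> T -> R).
Hypotheses (tauU : forall i, uniform01_rv P (tau i))
  (tauI : mutually_independent P tau).
Variables (d : nat) (a b K L rho : R) (eta : 'rV[R]_d).
Variables (f : R -> 'rV[R]_d -> 'rV[R]_d) (z : R -> 'rV[R]_d).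
Hypotheses (rho01 : 0 < rho <= 1) (K0 : 0 < K) (L0 : 0 < L).
Hypotheses (fF : in_F a b K L rho eta f) (zsol : ode_solution a b eta f z).
Variables (n : nat) (h q : R).
Hypotheses (n0 : (0 < n)%N) (hn : h * n%:R = b - a) (h0 : 0 < h) (h1 : h <= 1).
Hypotheses (Lhq : L * h <= q) (q1 : q < 1).

Let M := slope_holder d a b K L * (h * powR h rho).
Let s := M * Num.sqrt n%:R.
Let mps i w := max_partial_sum
  (fun j => padded_residual a f z n h i j (tau j w)) 1 n.

Let M0 : 0 < M.
Proof.
apply: mulr_gt0; first exact: slope_holder_gt0.
by apply: mulr_gt0 => //; exact: powR_gt0.
Qed.

Let sqrtn1 : 1 <= Num.sqrt n%:R :> R.
Proof. by rewrite -[leLHS]sqrtr1 ler_wsqrtr// ler1n. Qed.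

Let s0 : 0 < s.
Proof. by apply: mulr_gt0 => //; exact: lt_le_trans sqrtn1. Qed.

(** The exceptional realisations: off this null set the pathwise bound applies and clamping is the
    identity. *)
Let N := \bigcup_j (tau j @^-1` (~` `[0, 1])).

Let N_negligible : P.-negligible N.
Proof.
apply: negligible_bigcup => j; exists (tau j @^-1` (~` `[0, 1])); split => //.
- by rewrite -[X in measurable X]setTI; apply: (tauU j).1 => //; exact: measurableC.
- by apply: etrans ((tauU j).2 _ _) _; [exact: measurableC|rewrite setICl measure0].
Qed.

Let tau01 w : ~ N w -> forall j, 0 <= tau j w <= 1.
Proof.
move=> Nw j; apply: contrapT => H; apply: Nw; exists j => //=.
Qed.

Definition error_growth : R := expR (L / (1 - q) * (b - a)).

(** The deterministic part of the pathwise bound in units of [s]; it is only of size [M], and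
    [M <= s] because [sqrt n >= 1]. *)
Definition error_offset : R := L / (1 - q) * (b - a) * d%:R.

Let error_offset_ge0 : 0 <= error_offset.
Proof.
rewrite mulr_ge0// mulr_ge0//; last by rewrite -hn mulr_ge0// ltW.
by rewrite mulr_ge0 ?(ltW L0)// invr_ge0 subr_ge0 ltW.
Qed.

Let pathwise_error w : ~ N w ->
  \big[Num.max/0]_(j < n.+1)
     enorm (z (a + j%:R * h) - schemeS1 a h eta f (fun i => tau i w) j)
  <= s * (error_growth * (\sum_(i < d) mps i w / s + error_offset)).
Proof.
move=> Nw; have t01 := tau01 Nw.
have mps0 i : 0 <= mps i w by exact: max_partial_sum_ge0.
have S0 : 0 <= \sum_(i < d) mps i w by rewrite sumr_ge0.
have -> : s * (error_growth * (\sum_(i < d) mps i w / s + error_offset)) =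
    error_growth * (\sum_(i < d) mps i w + error_offset * s).
  rewrite -mulr_suml mulrCA mulrDr; congr (_ * (_ + _)); last exact: mulrC.
  by rewrite mulrCA divff ?mulr1// gt_eqF.
apply: bigmax_le => [|j _].
  rewrite mulr_ge0 ?expR_ge0// addr_ge0//.
  by apply: mulr_ge0 => //; exact: ltW.
apply: le_trans (@scheme_error_le _ d a b K L rho eta f z rho01 K0 L0 fF zsol n h q
  (fun i => tau i w) hn h0 h1 Lhq q1 t01 j _) _; first by rewrite -ltnS.
rewrite ler_wpM2l ?expR_ge0// lerD//.
  (* Clamping and padding are invisible here: each [tau l w] lies in [[0, 1]], and the indices
     satisfy [1 <= l <= n]. *)
  apply: ler_sum => i _; apply: max_partial_sum_le => // k kn.
  apply: le_trans (le_max_partial_sum _ _ kn).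
  rewrite le_eqVlt; apply/orP; left; apply/eqP; congr `|_|.
  apply: eq_big_nat => l /andP[l1 lk].
  rewrite /padded_residual l1 clamp01_id//=.
  by rewrite (leq_trans _ kn).
rewrite -/M mulrA ler_wpM2l//.
by rewrite /s ler_peMr// ltW.
Qed.

(** The 1 comes from [powR_le_add1_exprn], the next term from the deterministic offset, and the sum
    from the residual maxima of the [d] coordinates. *)
Definition error_const (m : nat) : R :=
  1 + (error_growth * 2) ^+ m.*2 * error_offset ^+ m.*2 +
  \sum_(i < d) (error_growth * 2) ^+ m.*2 * (2 ^+ m.*2) ^+ d
     * residual_moment_const m.

(** Factoring out [s] before comparing the power [p] with the power [2 m] keeps the homogeneous
    factor [powR s p] exact. Off [N] the maximum is dominated by a measurable function of the
    residual maxima. *)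
Lemma max_error_moment (p : R) (m : nat) : (1 < m)%N -> 0 <= p -> p <= m.*2%:R ->
  (\int[P]_w (powR (\big[Num.max/0]_(j < n.+1)
     enorm (z (a + j%:R * h) - schemeS1 a h eta f (fun i => tau i w) j)) p)%:E
   <= (powR s p * error_const m)%:E)%E.
Proof.
move=> m1 p0 pm.
have m0 : (0 < m.*2)%N by rewrite double_gt0 ltnW.
set A2 : R := (error_growth * 2) ^+ m.*2 * error_offset ^+ m.*2.
set A1 : R := (error_growth * 2) ^+ m.*2 * (2 ^+ m.*2) ^+ d.
have G0 : 0 <= error_growth by exact: expR_ge0.
have A20 : 0 <= A2 by rewrite mulr_ge0// exprn_ge0// mulr_ge0.
have A10 : 0 <= A1 by rewrite mulr_ge0// exprn_ge0// ?mulr_ge0// exprn_ge0.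
have mps0 i w : 0 <= mps i w by exact: max_partial_sum_ge0.
have mpsq0 i w : (0%R <= (mps i w ^+ m.*2)%:E)%E by rewrite lee_fin exprn_ge0.
have mmps i : measurable_fun setT (fun w => (mps i w ^+ m.*2)%:E).
  by apply/measurable_EFinP; apply: measurable_funX;
    exact: (@measurable_max_residual_sum _ _ _ P _ _ _ a b K L rho eta).
have c0 : (0%R <= (A1 / s ^+ m.*2)%:E)%E.
  by rewrite lee_fin divr_ge0// exprn_ge0// ltW.
have sp0 : (0%R <= (powR s p)%:E)%E by rewrite lee_fin powR_ge0.
have A2e : (0%R <= (1 + A2)%:E)%E by rewrite lee_fin addr_ge0.
pose F i w := ((A1 / s ^+ m.*2)%:E * (mps i w ^+ m.*2)%:E)%E.
have F0 i w : (0%R <= F i w)%E by rewrite mule_ge0.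
have mF i : measurable_fun setT (F i) by exact: emeasurable_funM.
have SF0 w : (0%R <= \sum_(i < d) F i w)%E by rewrite sume_ge0.
have mSF : measurable_fun setT (fun w => \sum_(i < d) F i w)%E by exact: emeasurable_sum.
have mf2 : measurable_fun setT (fun w => ((1 + A2)%:E + \sum_(i < d) F i w)%E).
  exact: emeasurable_funD.
have f20 w : (0%R <= (1 + A2)%:E + \sum_(i < d) F i w)%E by rewrite adde_ge0.
apply: (@le_trans _ _ (\int[P]_w ((powR s p)%:E *
    ((1 + A2)%:E + \sum_(i < d) F i w))%E)%E).
  apply: (@ae_le_integral_majorant _ _ _ P _ _ N) => //.
  - by move=> w; rewrite lee_fin powR_ge0.
  - by move=> w; rewrite mule_ge0.
  - exact: emeasurable_funM.
  move=> w Nw; rewrite /F sumEFin -EFinD -EFinM lee_fin.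
  set y := error_growth * (\sum_(i < d) mps i w / s + error_offset).
  have a0 i : 0 <= mps i w / s by rewrite divr_ge0// ltW.
  have S0 : 0 <= \sum_(i < d) mps i w / s by rewrite sumr_ge0.
  have y0 : 0 <= y by rewrite mulr_ge0// addr_ge0.
  apply: (@le_trans _ _ (powR (s * y) p)).
    apply: ge0_ler_powR; rewrite ?nnegrE//.
    - by elim/big_rec: _ => // j x _ x0; rewrite le_max x0 orbT.
    - by rewrite mulr_ge0// ltW.
    - exact: pathwise_error.
  rewrite powRM ?(ltW s0)// ler_wpM2l ?powR_ge0//.
  apply: le_trans (powR_le_add1_exprn y0 p0 pm) _; rewrite -addrA lerD2l.
  rewrite /y exprMn.
  apply: le_trans (ler_wpM2l (exprn_ge0 _ G0) (exprD_le _ S0 error_offset_ge0)) _.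
  rewrite mulrA -exprMn mulrDr -/A2 [leLHS]addrC lerD2l.
  apply: (@le_trans _ _ ((error_growth * 2) ^+ m.*2 *
      ((2 ^+ m.*2) ^+ d * \sum_(i < d) (mps i w / s) ^+ m.*2))).
    by rewrite ler_wpM2l ?exprn_ge0 ?mulr_ge0//; exact: expr_sum_le.
  rewrite mulrA -/A1 mulr_sumr ler_sum// => i _.
  by rewrite expr_div_n mulrA mulrAC.
rewrite ge0_integralZl// EFinM lee_wpmul2l//.
rewrite ge0_integralD// integral_cst// [X in (_ * X)%E](@probability_setT _ _ _ P) mule1.
rewrite /error_const [leRHS]EFinD leeD// ge0_integral_sum// -sumEFin lee_sum// => i _.
rewrite ge0_integralZl//.
apply: le_trans (lee_wpmul2l c0 (@residual_max_moment _ _ _ P tau tauU tauI d a b K L rho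
  eta f z rho01 K0 L0 fF zsol n h n0 hn h0 h1 m i m1)) _.
rewrite -EFinM lee_fin -/M -/s -/A1 le_eqVlt; apply/orP; left; apply/eqP.
have S0 : s ^+ m.*2 != 0 by rewrite expf_neq0// gt_eqF.
by rewrite mulrCA divfK// mulrC.
Qed.

End ErrorMoment.

(** * The convergence rate *)

(** Since [n = l / h], the factor [sqrt n] turns one of the two factors [sqrt h] contained in [h]
    into [sqrt l]: half an order is lost from [h^(1 + rho)]. *)
Lemma rate_rescaling {R : realType} (c h rho l : R) (n : nat) :
  0 < h -> h * n%:R = l ->
  c * (h * powR h rho) * Num.sqrt n%:R =
  c * Num.sqrt l * powR h (rho + 2^-1).
Proof.
move=> h0 hn.
rewrite powRD; last by rewrite (gt_eqF h0) implybT.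
rewrite powR12_sqrt ?(ltW h0)// -hn sqrtrM ?(ltW h0)//.
rewrite -[X in c * (X * _)](sqr_sqrtr (ltW h0)) expr2; ring.
Qed.

Theorem theorem1 (R : realType) (a b : R) (d : nat) (rho K L p : R) :
  a < b -> (0 < d)%N -> 0 < rho <= 1 -> 0 < K -> 0 < L -> 2 <= p ->
  exists C : R, 0 < C /\
    forall n : nat, (Num.floor (b - a) + 1 <= n%:Z)%R ->
    L * ((b - a) / n%:R) < 1 ->
    forall (eta : 'rV[R]_d) (f : R -> 'rV[R]_d -> 'rV[R]_d),
    in_F a b K L rho eta f ->
    forall (z : R -> 'rV[R]_d), ode_solution a b eta f z ->
    forall (dT : measure_display) (T : measurableType dT) (P : probability T R)
      (tau : nat -> T -> R),
    (forall i, uniform01_rv P (tau i)) -> mutually_independent P tau ->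
    let h := (b - a) / n%:R in
    (poweR (\int[P]_w
        (powR (\big[Num.max/0]_(j < n.+1)
                 enorm (z (a + j%:R * h) - schemeS1 a h eta f (fun i => tau i w) j))
              p)%:E)
       p^-1 <= (C * powR h (rho + 2^-1))%:E)%E.
Proof.
move=> ab d0 rho01 K0 L0 p2.
have ba0 : 0 < b - a by rewrite subr_gt0.
have p0 : 0 < p by exact: lt_le_trans p2.
have Lba0 : 0 < L * (b - a) by exact: mulr_gt0.
(* The least integer above [L * (b - a)]. Every admissible [n] is at least [N0], so [L * h <= q]
   with [q] chosen before [n]. *)
pose N0 : R := (Num.floor (L * (b - a)) + 1)%:~R.
have N0gt : L * (b - a) < N0 by exact: floorD1_gt.
have N00 : 0 < N0 by exact: lt_trans N0gt.
pose q := L * (b - a) / N0.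
have q1 : q < 1 by rewrite ltr_pdivrMr// mul1r.
(* Large enough for [p <= 2 m], and at least 2 as the maximal inequality requires. *)
pose m := (Num.bound p).+2.
have pm : p <= m.*2%:R.
  apply: ltW; apply: lt_le_trans (archi_boundP (ltW p0)) _.
  by rewrite ler_nat -addnn (leq_trans _ (leq_addr _ _))// leqW.
have m1 : (1 < m)%N by [].
pose H := slope_holder d a b K L.
have H0 : 0 < H by exact: slope_holder_gt0.
pose C2 := error_const d a b L q m.
have off0 : 0 <= error_offset d a b L q.
  rewrite mulr_ge0// mulr_ge0 ?(ltW ba0)// mulr_ge0 ?(ltW L0)//.
  by rewrite invr_ge0 subr_ge0 ltW.
have C20 : 0 < C2.
  rewrite /C2 /error_const -addrA ltr_pwDl// addr_ge0//.
    by rewrite mulr_ge0// exprn_ge0// mulr_ge0// expR_ge0.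
  rewrite sumr_ge0// => i _; rewrite mulr_ge0 ?residual_moment_const_ge0//.
  by rewrite mulr_ge0// exprn_ge0// ?exprn_ge0// mulr_ge0// expR_ge0.
(* The first two factors come from [rate_rescaling], the last is the [p]-th root of the moment
   constant. *)
exists (H * Num.sqrt (b - a) * powR C2 p^-1); split.
  by apply: mulr_gt0; [apply: mulr_gt0; rewrite ?sqrtr_gt0|exact: powR_gt0].
move=> n nfl Ln eta f fF z zsol dT T P tau tauU tauI.
lazy zeta; set h := (b - a) / n%:R.
(* The lower bound on [n] ensures [h <= 1], under which Lipschitz increments are dominated by
   [rho]-Hoelder ones. *)
have ban : b - a < n%:R.
  by apply: lt_le_trans (floorD1_gt _) _; rewrite -[n%:R]/(n%:Z%:~R) ler_int.
have nR0 : 0 < n%:R :> R by exact: lt_trans ban.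
have n0 : (0 < n)%N by rewrite -(ltr0n R).
have hn : h * n%:R = b - a by rewrite divfK// gt_eqF.
have h0 : 0 < h by exact: divr_gt0.
have h1 : h <= 1 by rewrite ler_pdivrMr// mul1r ltW.
have Lhq : L * h <= q.
  rewrite /h /q mulrA ler_wpM2l ?(ltW Lba0)// lef_pV2 ?posrE//.
  rewrite -[n%:R]/(n%:Z%:~R) ler_int lezD1 floor_lt_int.
  by move: Ln; rewrite mulrA ltr_pdivrMr// mul1r.
have E := max_error_moment tauU tauI rho01 K0 L0 fF zsol n0 hn h0 h1 Lhq q1
  m1 (ltW p0) pm.
rewrite (rate_rescaling H rho h0 hn) in E.
set s := H * _ * _ in E.
have s0 : 0 <= s.
  by rewrite mulr_ge0 ?powR_ge0// mulr_ge0 ?sqrtr_ge0// ltW.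
apply: (@le_trans _ _ (poweR (powR s p * C2)%:E p^-1)).
  apply: gt0_ler_poweR => //.
  - by rewrite invr_ge0 ltW.
  - by rewrite in_itv/= leey andbT integral_ge0// => w _; rewrite lee_fin powR_ge0.
  - by rewrite in_itv/= leey andbT lee_fin mulr_ge0 ?powR_ge0// ltW.
rewrite poweR_EFin lee_fin powRM ?powR_ge0 ?(ltW C20)// -powRrM divff ?gt_eqF//.
rewrite powRr1// /s le_eqVlt; apply/orP; left; apply/eqP; ring.
Qed.
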